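(* Let $r,d\ge 1$. Every $2$-generated verbally closed subgroup $H$ of the free solvable group $S_{r,d}$ is a retract of $S_{r,d}$.
   Context: For a group $G$, the derived series is $G^{(0)}=G$, $G^{(i+1)}=[G^{(i)},G^{(i)}]$. $S_{r,d}=F_r/F_r^{(d)}$, where $F_r$ is the free group of rank $r$. A subgroup $H\le G$ is verbally closed in $G$ if for every group word $w(x_1,\dots,x_n)$ (without constants) and every $h\in H$, if the equation $w(x_1,\dots,x_n)=h$ has a solution in $G$, then it has a solution in $H$. A subgroup $H\le G$ is a retract of $G$ if there is an endomorphism $\rho:G\to G$ with $\rho(G)\subseteq H$ that is the identity on $H$. *)

(* Defs.v *)
From mathcomp Require Import all_boot.
From Stdlib Require Import Relation_Operators.
Set Implicit Arguments. Unset Strict Implicit. Unset Printing Implicit Defensive.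

(** * The free group F_r, as words over letters x_i^{+-1}, i < r,
      modulo free reduction (setoid presentation). *)
Definition letter (r : nat) := ('I_r * bool)%type.   (* (i, true) = x_i, (i, false) = x_i^-1 *)
Definition fword (r : nat) := seq (letter r).

Definition linv r (a : letter r) : letter r := (a.1, ~~ a.2).
Definition winv r (u : fword r) : fword r := rev (map (@linv r) u).
Definition wmul r (u v : fword r) : fword r := u ++ v.
Definition wone r : fword r := [::].
Definition wcomm r (u v : fword r) : fword r :=
  wmul (winv u) (wmul (winv v) (wmul u v)).

Inductive fred1 r : fword r -> fword r -> Prop :=
| fred1_intro (u v : fword r) (a : letter r) :
    fred1 (u ++ a :: linv a :: v) (u ++ v).

Definition feq r : fword r -> fword r -> Prop := clos_refl_sym_trans _ (@fred1 r).

Inductive DerSucc r (P : fword r -> Prop) : fword r -> Prop :=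
| ds_comm a b : P a -> P b -> DerSucc P (wcomm a b)
| ds_one : DerSucc P (wone r)
| ds_mul x y : DerSucc P x -> DerSucc P y -> DerSucc P (wmul x y)
| ds_inv x : DerSucc P x -> DerSucc P (winv x)
| ds_feq x y : feq x y -> DerSucc P x -> DerSucc P y.

Fixpoint Der r (k : nat) : fword r -> Prop :=
  match k with
  | 0 => fun _ => True
  | k'.+1 => @DerSucc r (@Der r k')
  end.

(** * The free solvable group S_{r,d} = F_r / F_r^(d):
      carrier fword r, equality  u = v  iff  u v^-1 \in F_r^(d). *)
Definition Seq r d (u v : fword r) : Prop := @Der r d (wmul u (winv v)).

Inductive Gen2 r d (a b : fword r) : fword r -> Prop :=
| g2_a : Gen2 d a b a
| g2_b : Gen2 d a b b
| g2_one : Gen2 d a b (wone r)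
| g2_mul x y : Gen2 d a b x -> Gen2 d a b y -> Gen2 d a b (wmul x y)
| g2_inv x : Gen2 d a b x -> Gen2 d a b (winv x)
| g2_eq x y : Seq d x y -> Gen2 d a b x -> Gen2 d a b y.

Inductive gword : Type :=
| gvar : nat -> gword
| gone : gword
| gmul : gword -> gword -> gword
| ginv : gword -> gword.

Fixpoint geval r (f : nat -> fword r) (w : gword) : fword r :=
  match w with
  | gvar n => f n
  | gone => wone r
  | gmul w1 w2 => wmul (geval f w1) (geval f w2)
  | ginv w1 => winv (geval f w1)
  end.

Definition verbally_closed r d (H : fword r -> Prop) : Prop :=
  forall (w : gword) (h : fword r), H h ->
    (exists f : nat -> fword r, Seq d (geval f w) h) ->
    exists f : nat -> fword r, (forall i, H (f i)) /\ Seq d (geval f w) h.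

Definition retract r d (H : fword r -> Prop) : Prop :=
  exists rho : fword r -> fword r,
    (forall x y, Seq d x y -> Seq d (rho x) (rho y)) /\
    (forall x y, Seq d (rho (wmul x y)) (wmul (rho x) (rho y))) /\
    (forall x, H (rho x)) /\
    (forall h, H h -> Seq d (rho h) h).

(* Main.v *)
(** Let S = F/F^(d), let H be a verbally closed subgroup of S generated by a and b,
    and write S_k = F/F^(k). Solving "w(y) = h" in H, where w is the word spelling h,
    gives for every h in H an endomorphism T of S with values in H and T h = h.

    Suppose that a and b are independent in S_1 = Z^r and d = k + 1 >= 2. The Magnus
    embedding sees F^(k)/F^(k+1) as a module over the integral group ring of the
    torsion-free group S_k. Choose n <> 1 in H cap F^(k) and
    h = (1 + M a)(1 + M' b) n with large integers M, M'. Because group elements can be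
      read
    off from digits to a large base, T h = h forces T a = a and T b = b in S_k and
    T n = n. Then g |-> (T g) g^-1 is a derivation of H vanishing at n. For n the
    last term of the tower x_1 = [a, b], x_(j+1) = [x_j, a x_j a^-1], such a derivation
    is inner in the Magnus module, hence trivial on H cap F^(k). So T is unipotent on
    H, its restriction to H is invertible, and composing T with the inverse yields the
    retraction.

    If the image of H in Z^r is cyclic and d >= 2, verbal closedness gives
    H cap F' = [H, H], so the image of H cap F' in the Magnus module over Z[Z^r] is
    divisible by c - 1, where c generates H modulo F'; elements of finite support are
    not infinitely divisible, and H is cyclic. For d = 1 the subgroup H is pure in Z^r. *)
From HB Require Import structures.
Require Import Defs.
From mathcomp Require Import all_boot all_order all_algebra.
From mathcomp Require Import boolp.
From mathcomp Require Import zify ring.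
From Stdlib Require Import Relation_Operators.
Set Implicit Arguments. Unset Strict Implicit. Unset Printing Implicit Defensive.

(** * The groups F/F^(k) *)

Section Words.
Variable r : nat.
Implicit Types (u v w x y : fword r).

Lemma linvK : involutive (@linv r).
Proof. by case=> i b; rewrite /linv /= negbK. Qed.

Lemma winvM u v : winv (u ++ v) = winv v ++ winv u.
Proof. by rewrite /winv map_cat rev_cat. Qed.

Lemma winvK : involutive (@winv r).
Proof. by move=> u; rewrite /winv map_rev revK mapK //; exact: linvK. Qed.

Lemma feq_refl u : feq u u. Proof. exact: rst_refl. Qed.
Lemma feq_sym u v : feq u v -> feq v u. Proof. exact: rst_sym. Qed.
Lemma feq_trans v u w : feq u v -> feq v w -> feq u w.
Proof. exact: rst_trans. Qed.
Hint Resolve feq_refl : core.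

Lemma feq_ind_cong (f : fword r -> fword r) :
  (forall u v a, feq (f (u ++ a :: linv a :: v)) (f (u ++ v))) ->
  forall u v, feq u v -> feq (f u) (f v).
Proof.
move=> hf u v; elim=> [_ _ [x y a]|//|x y _|x y z _ h1 _ h2].
- exact: hf.
- exact: feq_sym.
- exact: feq_trans h1 h2.
Qed.

Lemma feq_cat2 u v x y : feq u v -> feq x y -> feq (u ++ x) (v ++ y).
Proof.
move=> uv xy; apply: (@feq_trans (v ++ x)).
  apply: (@feq_ind_cong (fun z => z ++ x)) uv => u' v' a.
  by rewrite -!catA /=; apply/rst_step/fred1_intro.
apply: (@feq_ind_cong (fun z => v ++ z)) xy => u' v' a.
by rewrite !catA; apply/rst_step/fred1_intro.
Qed.

Lemma feq_mulwV u : feq (u ++ winv u) [::].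
Proof.
elim/last_ind: u => [//|u a IH]; rewrite -cats1 winvM -catA /=.
by apply: feq_trans IH; apply/rst_step/fred1_intro.
Qed.

Lemma feq_mulVw u : feq (winv u ++ u) [::].
Proof. by rewrite -{2}[u]winvK; apply: feq_mulwV. Qed.

Lemma feq_mulKw u x : feq (winv u ++ (u ++ x)) x.
Proof.
rewrite catA -[X in feq _ X]cat0s.
by apply: feq_cat2 => //; apply: feq_mulVw.
Qed.

Lemma feq_mulVKw u x : feq (u ++ (winv u ++ x)) x.
Proof. by rewrite -{1}[u]winvK; apply: feq_mulKw. Qed.

End Words.

#[local] Hint Resolve feq_refl : core.

Section DerivedSeries.
Variable r : nat.
Implicit Types (u v w x y g : fword r) (P : fword r -> Prop) (k : nat).

Definition dser k P : fword r -> Prop := iter k (@DerSucc r) P.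

Lemma Der_dser k : @Der r k = dser k (fun => True).
Proof. by elim: k => //= k ->. Qed.

Definition feq_endo (T : fword r -> fword r) :=
  (forall u v, feq u v -> feq (T u) (T v)) /\
  (forall u v, feq (T (u ++ v)) (T u ++ T v)).

Lemma feq_endo1 T : feq_endo T -> feq (T [::]) [::].
Proof.
move=> [hT hM]; have h := hM [::] [::]; rewrite cats0 in h.
apply: feq_trans (feq_mulwV (T [::])).
apply: (@feq_trans _ (T [::] ++ (T [::] ++ winv (T [::])))).
  rewrite -[X in feq X _]cats0; apply: feq_cat2 => //.
  by apply: feq_sym; apply: feq_mulwV.
by rewrite catA; apply: feq_cat2 => //; apply: feq_sym.
Qed.

Lemma feq_endoV T u : feq_endo T -> feq (T (winv u)) (winv (T u)).
Proof.
move=> [hT hM].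
rewrite -[X in feq X _]cats0.
apply: (@feq_trans _ (T (winv u) ++ (T u ++ winv (T u)))).
  by apply: feq_cat2 => //; apply: feq_sym; apply: feq_mulwV.
rewrite catA -[X in feq _ X]cat0s; apply: feq_cat2 => //.
apply: feq_trans (feq_sym (hM _ _)) _.
apply: (@feq_trans _ (T [::])); first exact/hT/feq_mulVw.
exact: feq_endo1.
Qed.

Lemma DerSucc_endo T P P' : feq_endo T ->
  (forall u, P u -> P' (T u)) ->
  forall u, DerSucc P u -> DerSucc P' (T u).
Proof.
move=> eT hP u; have [hT hM] := eT; elim=> {u}.
- move=> a b Pa Pb; apply: (@ds_feq _ _ (wcomm (T a) (T b))); last first.
    by apply: ds_comm; apply: hP.
  rewrite /wcomm /wmul; apply: feq_sym.
  do 2 (apply: (feq_trans (hM _ _)); apply: feq_cat2; first exact: feq_endoV).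
  exact: hM.
- by apply: ds_feq (ds_one _); apply: feq_sym; apply: feq_endo1.
- move=> x y _ hx _ hy; apply: ds_feq (ds_mul hx hy); apply: feq_sym; exact: hM.
- move=> x _ hx; apply: ds_feq (ds_inv hx); apply: feq_sym; exact: feq_endoV.
- move=> x y xy _ hx; exact: ds_feq (hT _ _ xy) hx.
Qed.

(** For [P] everything and [P'] a subgroup containing the image of [T], this puts T(F^(k)) into the
    k-th derived subgroup of [P']. *)
Lemma dser_endo T P P' k : feq_endo T ->
  (forall u, P u -> P' (T u)) -> forall u, dser k P u -> dser k P' (T u).
Proof. by move=> eT hP; elim: k => //= k; apply: DerSucc_endo. Qed.

Lemma dser_mono P P' k : (forall u, P u -> P' u) ->
  forall u, dser k P u -> dser k P' u.
Proof. by apply: (@dser_endo id). Qed.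

Lemma Der_endo T k u : feq_endo T -> Der k u -> Der k (T u).
Proof. by move=> eT; rewrite Der_dser; apply: dser_endo. Qed.

Lemma feq_endo_conj g : feq_endo (fun u => g ++ u ++ winv g).
Proof.
split=> [u v uv|u v]; first by do 2 apply: feq_cat2 => //.
rewrite -!catA; do 2 apply: feq_cat2 => //.
exact/feq_sym/feq_mulKw.
Qed.

Lemma Der_conj k g u : Der k u -> Der k (g ++ u ++ winv g).
Proof. exact: (Der_endo (feq_endo_conj g)). Qed.

Lemma Der_one k : @Der r k [::].
Proof. by case: k => //= k; apply: ds_one. Qed.

Lemma Der_mul k u v : Der k u -> Der k v -> Der k (u ++ v).
Proof. by case: k => //= k; apply: ds_mul. Qed.

Lemma Der_inv k u : Der k u -> Der k (winv u).
Proof. by case: k => //= k; apply: ds_inv. Qed.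

Lemma Der_feq k u v : feq u v -> Der k u -> Der k v.
Proof. by case: k => //= k; apply: ds_feq. Qed.

Lemma Der_comm k u v : Der k u -> Der k v -> Der k.+1 (wcomm u v).
Proof. exact: ds_comm. Qed.

Lemma DerS k u : Der k.+1 u -> Der k u.
Proof.
elim=> {u} [a b ha hb|||u|u v].
- apply: Der_mul; first exact: Der_inv.
  by apply: Der_mul; [exact: Der_inv|exact: Der_mul].
- exact: Der_one.
- by move=> x y _ hx _ hy; apply: Der_mul.
- by move=> _; apply: Der_inv.
- by move=> uv _; apply: Der_feq uv.
Qed.

Lemma Der_le k l u : k <= l -> Der l u -> Der k u.
Proof.
by move/subnK <-; elim: (l - k) => //= n IH /(@DerS (n + k)).
Qed.

Lemma feq_Seq k u v : feq u v -> Seq k u v.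
Proof.
move=> uv; apply: (Der_feq _ (Der_one k)); apply: feq_sym.
by apply: feq_trans (feq_mulwV v); apply: feq_cat2.
Qed.

Lemma Seq_refl k u : Seq k u u. Proof. exact: feq_Seq. Qed.

Lemma Seq_sym k u v : Seq k u v -> Seq k v u.
Proof. by move/Der_inv; rewrite winvM winvK. Qed.

Lemma Seq_trans k v u w : Seq k u v -> Seq k v w -> Seq k u w.
Proof.
move=> uv vw; apply: Der_feq (Der_mul uv vw).
rewrite /wmul -catA; apply: feq_cat2 => //; exact: feq_mulKw.
Qed.

Lemma Seq_cat2 k u v x y : Seq k u v -> Seq k x y -> Seq k (u ++ x) (v ++ y).
Proof.
move=> uv xy; apply: (@Seq_trans k (u ++ y)).
  rewrite /Seq /wmul winvM catA -(catA u).
  by rewrite -catA; apply: (@Der_conj k u (x ++ winv y)).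
rewrite /Seq /wmul winvM; apply: Der_feq uv; rewrite -!catA.
apply: feq_cat2 => //; exact/feq_sym/feq_mulVKw.
Qed.

Lemma Seq_winv k u v : Seq k u v -> Seq k (winv u) (winv v).
Proof.
move=> uv; have h : feq (winv u ++ (u ++ winv u)) (winv u).
  by rewrite -[X in feq _ X]cats0; apply: feq_cat2 => //; apply: feq_mulwV.
apply: (@Seq_trans k (winv u ++ (v ++ winv v))).
  apply: (@feq_Seq k); rewrite -[X in feq X _]cats0; apply: feq_cat2 => //.
  exact/feq_sym/feq_mulwV.
apply: (@Seq_trans k (winv u ++ (u ++ winv v))).
  apply: Seq_cat2; first exact: Seq_refl.
  by apply: Seq_cat2; [exact: Seq_sym|exact: Seq_refl].
exact/feq_Seq/feq_mulKw.
Qed.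

Lemma Seq_le k l u v : k <= l -> Seq l u v -> Seq k u v.
Proof. exact: Der_le. Qed.

Lemma Seq_Der k u v : Seq k u v -> Der k v -> Der k u.
Proof.
move=> uv hv; apply: Der_feq (Der_mul uv hv).
by rewrite /wmul -catA -[X in feq _ X]cats0; apply: feq_cat2 => //; apply: feq_mulVw.
Qed.

Lemma Seq_Der1 k u : Seq k u [::] <-> Der k u.
Proof. by rewrite /Seq /wmul cats0. Qed.

Definition Srel k : rel (fword r) := fun u v => `[< Seq k u v >].

Lemma Srel_equiv k : equiv_class_of (Srel k).
Proof.
split=> [u|u v|v u w]; first exact/asboolP/Seq_refl.
  by apply/asboolP/asboolP; apply: Seq_sym.
by move=> /asboolP h1 /asboolP h2; apply/asboolP; apply: Seq_trans h2.
Qed.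

Canonical Srel_equivrel k := EquivRelPack (Srel_equiv k).

End DerivedSeries.

Local Open Scope quotient_scope.

Definition Sgrp r k := {eq_quot @Srel_equivrel r k}.
HB.instance Definition _ r k := Choice.on (Sgrp r k).
HB.instance Definition _ r k := EqQuotient.on (Sgrp r k).

Section SGroup.
Variables (r k : nat).
Local Notation Q := (Sgrp r k).

Definition cls (u : fword r) : Q := \pi_(Q) u.
Definition rep (g : Q) : fword r := repr g.

Lemma clsP u v : (cls u = cls v) <-> Seq k u v.
Proof.
split=> [/eqP|h]; last by apply/eqP; rewrite eqmodE; apply/asboolP.
by rewrite eqmodE => /asboolP.
Qed.

Lemma repK g : cls (rep g) = g. Proof. exact: reprK. Qed.

(* Locked, so that unification does not expose representatives. *)
Definition Sgrp_mul := locked (fun g h : Q => cls (rep g ++ rep h)).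
Definition Sgrp_inv := locked (fun g : Q => cls (winv (rep g))).

Lemma Sgrp_mulE u v : Sgrp_mul (cls u) (cls v) = cls (u ++ v).
Proof. by rewrite /Sgrp_mul -lock; apply/clsP/Seq_cat2; apply/clsP; rewrite repK. Qed.

Lemma Sgrp_invE u : Sgrp_inv (cls u) = cls (winv u).
Proof. by rewrite /Sgrp_inv -lock; apply/clsP/Seq_winv; apply/clsP; rewrite repK. Qed.

Lemma Sgrp_mulA : associative Sgrp_mul.
Proof.
move=> x y z; rewrite -[x]repK -[y]repK -[z]repK.
by rewrite !Sgrp_mulE catA.
Qed.

Lemma Sgrp_mul1 : left_id (cls [::]) Sgrp_mul.
Proof. by move=> x; rewrite -[x]repK Sgrp_mulE. Qed.

Lemma Sgrp_mulV : left_inverse (cls [::]) Sgrp_inv Sgrp_mul.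
Proof.
move=> x; rewrite -[x]repK Sgrp_invE Sgrp_mulE.
exact/clsP/feq_Seq/feq_mulVw.
Qed.

Lemma Sgrp_mulx1 : right_id (cls [::]) Sgrp_mul.
Proof. by move=> x; rewrite -[x]repK Sgrp_mulE cats0. Qed.

Lemma Sgrp_mulxV : right_inverse (cls [::]) Sgrp_inv Sgrp_mul.
Proof.
move=> x; rewrite -[x]repK Sgrp_invE Sgrp_mulE.
exact/clsP/feq_Seq/feq_mulwV.
Qed.

End SGroup.
HB.instance Definition _ r k := isGroup.Build (Sgrp r k)
  (@Sgrp_mulA r k) (@Sgrp_mul1 r k) (@Sgrp_mulx1 r k)
  (@Sgrp_mulV r k) (@Sgrp_mulxV r k).

Section SGroupTheory.
Variables (r k : nat).
Implicit Types (u v : fword r).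
Local Notation cls := (@cls r k).
Open Scope group_scope.

Lemma clsM u v : cls (u ++ v) = cls u * cls v.
Proof. by rewrite -Sgrp_mulE. Qed.

Lemma clsV u : cls (winv u) = (cls u)^-1.
Proof. by rewrite -Sgrp_invE. Qed.

Lemma cls1 : cls [::] = 1. Proof. by []. Qed.

Lemma cls_eq1 u : (cls u = 1) <-> Der k u.
Proof. by rewrite -cls1 clsP Seq_Der1. Qed.

End SGroupTheory.

(** * Finitely supported functions on a torsion-free group *)

Import Order.TTheory GRing.Theory Num.Theory.

Section FiniteSupport.
Variable Q : groupType.
Implicit Types (u v w : Q -> int) (g x y z c : Q).
Local Open Scope group_scope.

(** Such functions stand for elements of the group ring Z[Q]: [fun z => v (g^-1 * z)] is g v, and
    [fun z => v (z * g^-1)] is v g. *)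
Definition fsup v := exists s : seq Q, forall z, v z <> 0%R -> z \in s.

Definition infinite_order g := forall m n, g ^+ m = g ^+ n -> m = n.

Definition torsion_free := forall g n, g ^+ n.+1 = 1 -> g = 1.

Lemma torsion_free_order g : torsion_free -> g <> 1 -> infinite_order g.
Proof.
move=> tf g1 m n; wlog le_mn : m n / (m <= n)%N => [hw|].
  by case: (leqP m n) => [/hw //|/ltnW /hw h /esym /h].
rewrite -(subnKC le_mn) expgnDr -{1}[g ^+ m]mulg1 => /mulgI /esym.
by case: (n - m)%N => [|k /tf]; rewrite ?addn0.
Qed.

Lemma fsup_tr v g : fsup v -> fsup (fun z => v (g * z)%g).
Proof.
move=> [s hs]; exists [seq g^-1 * z | z <- s] => z /hs hz.
by rewrite -[z](mulKg g) map_f.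
Qed.

Lemma fsup_add u v : fsup u -> fsup v -> fsup (fun z => u z + v z)%R.
Proof.
move=> [s hs] [t ht]; exists (s ++ t) => z nz; rewrite mem_cat.
by case: (eqVneq (u z) 0%R) => [u0|/eqP/hs ->//]; rewrite ht ?orbT //; lia.
Qed.

Lemma fsup_mono u v : (forall z, v z <> 0%R -> u z <> 0%R) -> fsup u -> fsup v.
Proof. by move=> h [s hs]; exists s => z /h /hs. Qed.

Lemma fsup_opp v : fsup v -> fsup (fun z => - v z)%R.
Proof. by apply: fsup_mono => z; lia. Qed.

Lemma fsup_sub u v : fsup u -> fsup v -> fsup (fun z => u z - v z)%R.
Proof. by move=> hu /fsup_opp; apply: fsup_add. Qed.

Lemma fsup_escape v g z : fsup v -> infinite_order g ->
  exists n, v (g ^+ n * z)%g = 0%R.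
Proof.
move=> [s hs] hg; apply: contrapT => hn.
have hin n : g ^+ n * z \in s by apply: hs => h; apply: hn; exists n.
have: (size (mkseq (fun n => g ^+ n * z)%g (size s).+1) <= size s)%N.
  apply: uniq_leq_size => [|_ /mapP[n _ ->] //].
  by apply/mkseq_uniq => m n /mulIg /hg.
by rewrite size_mkseq ltnn.
Qed.

(** A nonzero value would recur at all g^n z, against finite support: multiplication by g - 1 is
    injective. *)
Lemma shift_invariant0 v g : fsup v -> infinite_order g ->
  (forall z, v (g * z)%g = v z) -> forall z, v z = 0%R.
Proof.
move=> fv hg inv z; have [n <-] := fsup_escape z fv hg.
by elim: n => [|n IH]; rewrite ?mul1g // expgS -mulgA inv.
Qed.

Lemma shiftV_invariant0 v g : fsup v -> infinite_order g ->
  (forall z, v (g^-1 * z)%g = v z) -> forall z, v z = 0%R.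
Proof.
move=> fv hg inv; apply: (shift_invariant0 fv hg) => z.
by rewrite -inv mulKg.
Qed.

Lemma fsup_bound v : fsup v -> exists B : nat, forall z, (absz (v z) <= B)%N.
Proof.
move=> [s hs]; exists (\max_(y <- s) absz (v y)) => z.
have [->//|/eqP/hs zs] := eqVneq (v z) 0%R.
exact: (@leq_bigmax_seq _ s predT (fun y => absz (v y)) z).
Qed.

Lemma fsup_max v z : fsup v -> v z <> 0%R ->
  exists z0, v z0 <> 0%R /\ forall y, (absz (v y) <= absz (v z0))%N.
Proof.
move=> fv vz; have [B hB] := fsup_bound fv.
pose P n := `[< exists y, absz (v y) = n >].
have exP : exists n, P n by exists (absz (v z)); apply/asboolP; exists z.
have hP n : P n -> (n <= B)%N by move=> /asboolP[y <-].
case: (ex_maxnP exP hP) => n /asboolP[y <-] hy; exists y.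
have h t : (absz (v t) <= absz (v y))%N by apply/hy/asboolP; exists t.
by split=> // vy; have := h z; rewrite vy; lia.
Qed.

(** At z0 with |v z0| maximal and nonzero, the equation at q z0 reads v(q z0) = - M v(z0), which is
    too large. *)
Lemma one_plus_inj v q (M : nat) : fsup v -> (1 < M)%N ->
  (forall z, v z + M%:Z * v (q^-1 * z)%g = 0)%R -> forall z, v z = 0%R.
Proof.
move=> fv M1 h z; apply: contrapT => /(fsup_max fv)[z0 [v0 hz0]].
have := h (q * z0); rewrite mulKg; have := hz0 (q * z0); nia.
Qed.

(* The difference [v' - v] is M t with t + M p t = q v - p v; where |t| is maximal,
   M p t dominates, so t = 0 and q v = p v. *)
Lemma one_plus_rigid v v' p q (M : nat) : torsion_free ->
  fsup v -> fsup v' -> (exists z, v z <> 0%R) ->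
  (forall z, 2 * absz (v z) + 1 < M)%N ->
  (forall z, v' z + M%:Z * v' (p^-1 * z)%g = v z + M%:Z * v (q^-1 * z)%g)%R ->
  p = q.
Proof.
move=> tf fv fv' [z1 vz1] hM h.
pose t z : int := (v (q^-1 * z)%g - v' (p^-1 * z)%g)%R.
have tE z : (v' z - v z = M%:Z * t z)%R by rewrite /t; have := h z; lia.
have M0 z : (0 < M)%N by have := hM z; lia.
have tD z : (t z + M%:Z * t (p^-1 * z)%g = v (q^-1 * z)%g - v (p^-1 * z)%g)%R.
  by rewrite -tE /t; lia.
have t0 z : t z = 0%R.
  apply: contrapT => /fsup_max[|z0 [tz0 hz0]].
    exact: (fsup_sub (fsup_tr _ fv) (fsup_tr _ fv')).
  have := tD (p * z0); rewrite mulKg; have := hz0 (p * z0).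
  have := hM (q^-1 * (p * z0)); have := hM z0; nia.
apply: contrapT => pq.
have h1 : p^-1 * q <> 1 by move=> e; apply: pq; rewrite -[q](mulVKg p) e mulg1.
apply: vz1; apply: (shift_invariant0 fv (torsion_free_order tf h1)) => z.
by have := tD (q * z); rewrite !t0 mulKg mulgA GRing.mulr0 GRing.addr0 => /esym/eqP;
  rewrite GRing.subr_eq0 => /eqP ->.
Qed.

(** For commuting [x] and [y], natural exponents are enough to say that they generate a free abelian
    group of rank 2. *)
Definition independent x y := forall m n m' n',
  x ^+ m * y ^+ n = x ^+ m' * y ^+ n' -> m = m' /\ n = n'.

Lemma eventually_seq (T : eqType) (bad : nat -> T -> Prop) (s : seq T) :
  (forall t, exists K0, forall K, (K0 <= K)%N -> ~ bad K t) ->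
  exists K0, forall K, (K0 <= K)%N -> forall t, t \in s -> ~ bad K t.
Proof.
move=> h; elim: s => [|a s [K1 h1]]; first by exists 0%N.
have [K2 h2] := h a; exists (maxn K1 K2) => K; rewrite geq_max => /andP[k1 k2] t.
by rewrite inE => /orP[/eqP->|]; [exact: h2|exact: h1].
Qed.

(* For K large, the translate by x^K of the set P of <y>-cosets meeting the support
   of [u] is disjoint from P; restricting (x^K - 1) u = (y - 1) (sum_(j < K) x^j v)
   to P then exhibits [u] as a multiple of y - 1. *)
Lemma coprime_factor x y u v : commute x y -> independent x y ->
  fsup u -> fsup v ->
  (forall z, u (x^-1 * z)%g - u z = v (y^-1 * z)%g - v z)%R ->
  exists mu, [/\ fsup mu, forall z, (u z = mu (y^-1 * z)%g - mu z)%R &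
                 forall z, (v z = mu (x^-1 * z)%g - mu z)%R].
Proof.
move=> cxy ind fu fv huv; have [s hs] := fu.
(* x^K t1 lies in the <y>-coset of t2. *)
pose bad K (t : Q * Q) := exists i j, y ^+ i * (x ^+ K * t.1) = y ^+ j * t.2.
have [K hK] : exists K, forall t1 t2, t1 \in s -> t2 \in s -> ~ bad K (t1, t2).
  have [|K0 h0] := @eventually_seq _ bad [seq (t1, t2) | t1 <- s, t2 <- s].
    move=> t; have [[K bK]|nb] := pselect (exists K, bad K t); last first.
      by exists 0%N => K _ bK; apply: nb; exists K.
    (* By independence a given pair is bad for at most one K. *)
    exists K.+1 => K' ltK bK'.
    case: bK => [i [j e]]; case: bK' => [i' [j' e']].
    have e1 : y ^+ (j' + i) * (x ^+ K * t.1) = y ^+ (j + i') * (x ^+ K' * t.1).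
      by rewrite !expgnDr -!mulgA e e' !mulgA -!expgnDr addnC.
    suff: K = K' by lia.
    move: e1; rewrite !mulgA => /mulIg.
    have cX m n : y ^+ m * x ^+ n = x ^+ n * y ^+ m by apply/commute_sym/commuteX2.
    by rewrite !cX => /ind[].
  exists K0 => t1 t2 h1 h2; apply: h0 => //.
  by apply/allpairsP; exists (t1, t2).
pose P z := exists2 z0, z0 \in s & exists i j, y ^+ i * z = y ^+ j * z0.
have Py z : P (y^-1 * z) <-> P z.
  split=> -[z0 zs [i [j e]]]; exists z0 => //.
    exists i, j.+1.
    by rewrite expgS -mulgA -e (mulgA y) -expgS expgSr -mulgA mulVKg.
  by exists i.+1, j; rewrite expgSr -mulgA mulVKg.
(* [vK n] is (1 + x + ... + x^(n-1)) v, so (x^n - 1) u = (y - 1) [vK n]. *)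
pose vK n z : int := (\sum_(j < n) v ((x ^+ j)^-1 * z)%g)%R.
have cyx n z : (x ^+ n)^-1 * (y^-1 * z) = y^-1 * ((x ^+ n)^-1 * z).
  rewrite !mulgA; congr (_ * _); apply: commuteV; apply/commute_sym/commuteV.
  exact/commuteX/commute_sym.
have hvK n z : (u ((x ^+ n)^-1 * z)%g - u z = vK n (y^-1 * z)%g - vK n z)%R.
  elim: n => [|n IH]; first by rewrite /vK !big_ord0 invg1 mul1g; lia.
  rewrite /vK !big_ord_recr -/(vK n _) -/(vK n _) /= cyx.
  have -> : (x ^+ n.+1)^-1 * z = x^-1 * ((x ^+ n)^-1 * z).
    by rewrite mulgA -invgM -expgSr.
  by have := huv ((x ^+ n)^-1 * z); lia.
have fvK n : fsup (vK n).
  elim: n => [|n IH].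
    by exists [::] => z; rewrite /vK big_ord0.
  apply: (@fsup_mono (fun z => vK n z + v ((x ^+ n)^-1 * z)%g)%R) => [z|].
    by rewrite /vK big_ord_recr.
  by apply: fsup_add => //; apply: fsup_tr.
(* On P the term x^K u vanishes, which leaves -u = (y - 1) [vK K]; off P, u itself is 0. *)
pose mu z : int := (if `[< P z >] then - vK K z else 0)%R.
have fmu : fsup mu.
  by apply: fsup_mono (fvK K) => z; rewrite /mu; case: ifP => _; lia.
have umu z : (u z = mu (y^-1 * z)%g - mu z)%R.
  rewrite /mu (asbool_equiv_eq (Py z)); case: asboolP => [Pz|nP].
    suff u0 : u ((x ^+ K)^-1 * z) = 0%R by have := hvK K z; lia.
    apply: contrapT => /hs zs; case: Pz => [z0 z0s [i [j e]]].
    by apply: (hK _ _ zs z0s); exists i, j; rewrite /= mulVKg.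
  suff -> : u z = 0%R by lia.
  by apply: contrapT => /hs zs; apply: nP; exists z => //; exists 0%N, 0%N.
(* v - (x - 1) mu is killed by y - 1, hence zero. *)
exists mu; split=> // z; apply/eqP; rewrite -subr_eq0; apply/eqP.
move: z; apply: (@shiftV_invariant0 _ y).
- by apply: fsup_sub => //; apply: fsup_sub => //; apply: fsup_tr.
- by move=> m n e; have [] := ind 0%N m 0%N n; rewrite ?mul1g.
- move=> z; have := huv z; rewrite !umu.
  have := cyx 1%N z; rewrite expg1 => ->; lia.
Qed.

(** * Gradings by homomorphisms to Z *)

Section Grading.
Variable chi : Q -> int.
Hypothesis chiM : forall g h, chi (g * h)%g = (chi g + chi h)%R.

Lemma chi1 : chi 1 = 0%R.
Proof. by have := chiM 1 1; rewrite mulg1; lia. Qed.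

Lemma chiV g : chi g^-1 = (- chi g)%R.
Proof. by have := chiM g g^-1; rewrite mulgV chi1; lia. Qed.

Lemma chiX g n : chi (g ^+ n)%g = (n%:Z * chi g)%R.
Proof. by elim: n => [|n IH]; rewrite ?chi1 ?expgS ?chiM ?IH; lia. Qed.

Lemma chi_order g : chi g <> 0%R -> infinite_order g.
Proof. by move=> g0 m n /(congr1 chi); rewrite !chiX; nia. Qed.

Lemma fsup_chi_bound v : fsup v ->
  exists L : nat, forall z, v z <> 0%R -> (- L%:Z <= chi z < L%:Z)%R.
Proof.
move=> [s hs]; exists (\max_(y <- s) absz (chi y)).+1 => z /hs zs.
have : (absz (chi z) <= \max_(y <- s) absz (chi y))%N.
  exact: (@leq_bigmax_seq _ s predT (fun y => absz (chi y)) z).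
lia.
Qed.

(** The hypothesis reads (1 - y + x a - a) v = 0. As [a] raises degrees while [x] and [y] preserve
    them, the lowest component of v is killed by 1 - y; induction on the degree. *)
Lemma graded_inj x y a v : (0 < chi a)%R -> chi x = 0%R -> chi y = 0%R ->
  infinite_order y -> fsup v ->
  (forall z, v z - v (y^-1 * z)%g + v (a^-1 * (x^-1 * z))%g - v (a^-1 * z)%g = 0)%R ->
  forall z, v z = 0%R.
Proof.
move=> a0 x0 y0 oy fv h; have [L hL] := fsup_chi_bound fv.
suff H n z : (chi z < - L%:Z + n%:Z)%R -> v z = 0%R.
  by move=> z; apply: (H (absz (chi z) + L).+1); lia.
elim: n z => [|n IH] z hz.
  by apply: contrapT => /hL; lia.
pose v0 z : int := (if chi z == - L%:Z + n%:Z then v z else 0)%R.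
have [e|ne] := eqVneq (chi z) (- L%:Z + n%:Z)%R; last by apply: IH; lia.
have: v0 z = 0%R; last by rewrite /v0 e eqxx.
move: (z); apply: (@shiftV_invariant0 _ y) => //.
  by apply: fsup_mono fv => t; rewrite /v0; case: ifP.
move=> t; rewrite /v0 chiM chiV y0 oppr0 add0r; case: ifP => // /eqP et.
have := h t; rewrite [v (a^-1 * _)%g]IH ?[v (a^-1 * t)%g]IH ?chiM ?chiV; lia.
Qed.

(** The equation is (c - 1) w = v. Below [l], and from [l + L] upwards, w is constant along a ray of
    powers of c, and the ray leaves the finite support of w. *)
Lemma width_shrink c v w l (L : nat) : (0 < chi c)%R -> fsup w ->
  (forall z, w (c^-1 * z)%g - w z = v z)%R ->
  (forall z, v z <> 0 -> l <= chi z < l + L.+1%:Z)%R ->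
  (forall z, w z <> 0 -> l <= chi z < l + L%:Z)%R.
Proof.
move=> c0 fw h hv z wz.
have v0 t : ~ (l <= chi t < l + L.+1%:Z)%R -> v t = 0%R.
  by move=> ht; apply: contrapT => /hv.
apply: contrapT => hz; apply: wz.
have [lz|lz] := ltP (chi z) l.
  have oc : infinite_order c^-1 by apply: chi_order; rewrite chiV; lia.
  have [n <-] := fsup_escape z fw oc; elim: n => [|n IH]; first by rewrite mul1g.
  rewrite IH expgS -mulgA; have := h (c^-1 ^+ n * z); rewrite v0;
    last by rewrite chiM chiX chiV; nia.
  by move=> /eqP; rewrite subr_eq0 => /eqP ->.
have oc : infinite_order c by apply: chi_order; lia.
have [n <-] := fsup_escape z fw oc; elim: n => [|n IH]; first by rewrite mul1g.
rewrite IH expgS -mulgA; have := h (c * (c ^+ n * z)); rewrite mulKg v0;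
  last by rewrite !chiM chiX; nia.
by move=> /eqP; rewrite subr_eq0 => /eqP ->.
Qed.

End Grading.

Lemma graded_inj_neq (chi : Q -> int) x y a v :
  (forall g h, chi (g * h)%g = (chi g + chi h)%R) ->
  chi a <> 0%R -> chi x = 0%R -> chi y = 0%R -> infinite_order y -> fsup v ->
  (forall z, v z - v (y^-1 * z)%g + v (a^-1 * (x^-1 * z))%g - v (a^-1 * z)%g = 0)%R ->
  forall z, v z = 0%R.
Proof.
move=> chiM a0 x0 y0; have [ap|an] := ltP 0%R (chi a).
  exact: (graded_inj chiM).
apply: (@graded_inj (fun g => - chi g)%R); rewrite ?x0 ?y0 //; last by lia.
by move=> g h; rewrite chiM opprD.
Qed.

End FiniteSupport.

(** * Fox calculus *)

Lemma sum_support (T : eqType) (f : T -> int) (s1 s2 : seq T) :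
  uniq s1 -> uniq s2 -> (forall z, f z <> 0%R -> z \in s1) ->
  (forall z, f z <> 0%R -> z \in s2) ->
  (\sum_(z <- s1) f z = \sum_(z <- s2) f z)%R.
Proof.
move=> u1 u2 h1 h2.
have E s : (\sum_(z <- s) f z = \sum_(z <- s | f z != 0) f z)%R.
  by rewrite [RHS]big_mkcond; apply: eq_bigr => z _; case: eqP.
rewrite (E s1) (E s2) -!(big_filter _ (fun z => f z != 0%R)); apply: perm_big.
apply: uniq_perm; rewrite ?filter_uniq // => z; rewrite !mem_filter.
by case: (eqVneq (f z) 0%R) => //= /eqP nz; rewrite h1 ?h2.
Qed.

(** The augmentation of v (g - 1) is zero. *)
Lemma fsup_total_shift (Q : groupType) (v : Q -> int) (S : seq Q) g :
  uniq S -> (forall z, v z <> 0%R -> z \in S /\ (z * g)%g \in S) ->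
  (\sum_(z <- S) (v (z * g^-1)%g - v z) = 0)%R.
Proof.
move=> uS hS; rewrite sumrB; apply/eqP; rewrite subr_eq0; apply/eqP.
rewrite -(big_map (fun z => z * g^-1)%g xpredT v); apply: sum_support => //.
- by rewrite map_inj_uniq //; apply: mulIg.
- by move=> z /hS[_ zS]; apply/mapP; exists (z * g)%g; rewrite ?mulgK.
- by move=> z /hS[].
Qed.

(** The opposite of the first factor occurs later, commutes past what lies between, and cancels
    it. *)
Lemma prod_signed_pairs (E : eqType) (G : groupType) (f : E -> G)
    (L : seq (E * bool)) :
  (forall e e', commute (f e) (f e')) ->
  (forall e, count_mem (e, true) L = count_mem (e, false) L) ->
  (\prod_(p <- L) (if p.2 then f p.1 else (f p.1)^-1) = 1)%g.
Proof.
move=> cf; set F := fun p : E * bool => if p.2 then f p.1 else (f p.1)^-1%g.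
rewrite -/(\prod_(p <- L) F p)%g.
have cF p q : commute (F p) (F q).
  rewrite /F; case: p.2; case: q.2; do ?[exact: commuteV]; do ?exact: cf.
    by apply/commute_sym/commuteV.
  by apply: commuteV; apply/commute_sym/commuteV.
have [n] := ubnP (size L); elim: n L => // n IH [|[e b] L] /=.
  by rewrite big_nil.
rewrite ltnS => szL hc.
have eL : (e, ~~ b) \in L.
  rewrite -has_pred1 has_count; move: hc => /(_ e); rewrite !xpair_eqE !eqxx /=.
  by case: b => /=; rewrite add0n add1n; [move<-|move->].
case: (splitPr eL) hc szL => L1 L2 hc szL.
rewrite big_cons big_cat big_cons.
have -> : F (e, ~~ b) = (F (e, b))^-1%g by rewrite /F /=; case: (b); rewrite ?invgK.
have cP : commute (F (e, b)) (\prod_(p <- L1) F p)%g.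
  by apply: commute_prod => p _; apply: cF.
rewrite mulgA cP -mulgA mulVKg -big_cat; apply: IH.
  by move: szL; rewrite !size_cat /=; lia.
clear -hc; move=> e'; move: hc => /(_ e'); rewrite !count_cat /= !xpair_eqE.
by case: b; case: (e == e') => /=; lia.
Qed.

Section Fox.
Variable r k : nat.
Implicit Types (u v w : fword r) (i j : 'I_r) (a : letter r).
Local Notation Q := (Sgrp r k).
Local Notation cls := (@cls r k).
Implicit Types (g h z : Q).
Local Open Scope group_scope.

Definition gen j : Q := cls [:: (j, true)].

(** The Fox derivative of a letter: 1 for x_i, - x_i^-1 for x_i^-1, and 0 for other generators. *)
Definition fox1 i a z : int :=
  if (i == a.1) && (z == if a.2 then 1%g else cls [:: a]) then ((-1) ^+ (~~ a.2))%R
  else 0%R.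

Fixpoint fox i w z : int :=
  if w is a :: w' then (fox1 i a z + fox i w' ((cls [:: a])^-1 * z)%g)%R else 0%R.

Lemma cls_cons a w : cls (a :: w) = cls [:: a] * cls w.
Proof. by rewrite -clsM. Qed.

Lemma cls_linv a : cls [:: linv a] = (cls [:: a])^-1.
Proof. by rewrite -clsV. Qed.

Lemma fox_cat i u v z :
  fox i (u ++ v) z = (fox i u z + fox i v ((cls u)^-1 * z)%g)%R.
Proof.
elim: u z => [|a u IH] z /=; first by rewrite invg1 mul1g add0r.
by rewrite IH addrA (cls_cons a u) invgM mulgA.
Qed.

Lemma fox_linv2 i a z : fox i [:: a; linv a] z = 0%R.
Proof.
have E1 : ((cls [:: a])^-1 * z == (cls [:: a])^-1) = (z == 1).
  by rewrite -[X in _ == X]mulg1 (inj_eq (mulgI _)).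
have E2 : ((cls [:: a])^-1 * z == 1) = (z == cls [:: a]).
  by rewrite -(mulVg (cls [:: a])) (inj_eq (mulgI _)).
rewrite /= addr0 /fox1 /= cls_linv.
case: a E1 E2 => j [] /= E1 E2; rewrite ?E1 ?E2; case: (_ && _) => //; lia.
Qed.

Lemma fox_feq i u v z : feq u v -> fox i u z = fox i v z.
Proof.
move=> uv; elim: uv z => {u v} [_ _ [u v a]|//|u v _ IH|u v w _ IH1 _ IH2] z.
- rewrite !fox_cat -cat1s -[linv a :: v]cat1s catA fox_cat fox_linv2 add0r.
  by rewrite -cat1s clsM cls_linv mulgV invg1 mul1g.
- by rewrite IH.
- by rewrite IH1.
Qed.

Definition wsubgroup (K : fword r -> Prop) :=
  [/\ K [::], forall u v, K u -> K v -> K (u ++ v) & forall u, K u -> K (winv u)].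

(** Crossed homomorphisms into Z[F/F^(k)]. The subgroup [K] is a parameter because the derivation
    measuring how T moves H is only known to obey the product rule on H. *)
Definition derivation (K : fword r -> Prop) (E : fword r -> Q -> int) :=
  [/\ wsubgroup K, forall u v z, feq u v -> E u z = E v z &
      forall u v z, K u -> K v -> E (u ++ v) z = (E u z + E v ((cls u)^-1 * z)%g)%R].

Section DerivationTheory.
Variables (K : fword r -> Prop) (E : fword r -> Q -> int).
Hypothesis dE : derivation K E.

Lemma derivation1 z : E [::] z = 0%R.
Proof.
by case: dE => -[K1 _ _] _ EM; have := EM _ _ z K1 K1; rewrite /= invg1 mul1g; lia.
Qed.

Lemma derivation_winv u z : K u -> E (winv u) z = (- E u (cls u * z)%g)%R.
Proof.
case: dE => -[K1 KM KV] Ef EM Ku.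
have := Ef _ _ (cls u * z) (feq_mulwV u).
by rewrite EM ?derivation1 ?mulKg; [lia| |exact: KV].
Qed.

(** Expand E on v u [u, v] = u v. In the group ring: (v u) E[u, v] = (1 - v) E u + (u - 1) E v. *)
Lemma derivation_comm u v z : K u -> K v ->
  E (wcomm u v) ((cls v * cls u)^-1 * z) =
  (E u z + E v ((cls u)^-1 * z)%g - E v z - E u ((cls v)^-1 * z)%g)%R.
Proof.
case: dE => -[K1 KM KV] Ef EM Ku Kv.
have Kc : K (wcomm u v).
  exact: KM (KV _ Ku) (KM _ _ (KV _ Kv) (KM _ _ Ku Kv)).
have h : feq (v ++ u ++ wcomm u v) (u ++ v).
  rewrite /wcomm /wmul; apply: feq_trans (feq_mulVKw v _).
  by apply: feq_cat2 => //; apply: feq_mulVKw.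
move: (wcomm u v) Kc h => c Kc h.
have -> : (cls v * cls u)^-1 * z = (cls u)^-1 * ((cls v)^-1 * z).
  by rewrite invgM mulgA.
have := Ef _ _ z h; rewrite !EM //; last exact: KM.
by lia.
Qed.

Lemma derivation_conj u v z : K u -> K v ->
  E (u ++ v ++ winv u) z = (E u z + E v ((cls u)^-1 * z)%g
    - E u ((cls (u ++ v ++ winv u))^-1 * z)%g)%R.
Proof.
move=> Ku Kv; have [[K1 KM KV] Ef EM] := dE.
have Ku' := KV _ Ku; rewrite !EM ?derivation_winv //; last exact: KM.
by rewrite !clsM clsV !invgM invgK !mulgA addrA.
Qed.

End DerivationTheory.

Lemma fox_derivation i : derivation (fun=> True) (fox i).
Proof. by split=> // [u v z|u v z _ _]; [exact: fox_feq|exact: fox_cat]. Qed.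

Lemma fox_winv i u z : fox i (winv u) z = (- fox i u (cls u * z)%g)%R.
Proof. exact: derivation_winv (fox_derivation i) _ _ _. Qed.

Lemma fsup_fox i w : fsup (fox i w).
Proof.
elim: w => [|a w IH]; first by exists [::].
apply: fsup_add; last exact: fsup_tr.
exists [:: if a.2 then 1 else cls [:: a]] => z; rewrite /fox1 inE.
by case: eqP => //= _; case: eqP.
Qed.

Lemma fox_comm0 i u v z : cls u = 1 -> cls v = 1 -> fox i (wcomm u v) z = 0%R.
Proof.
move=> u1 v1; have := derivation_comm (fox_derivation i) z (u := u) (v := v) I I.
by rewrite u1 v1 mulg1 !invg1 !mul1g; lia.
Qed.

Lemma fox_Der i w z : Der k.+1 w -> fox i w z = 0%R.
Proof.
move=> hw; elim: hw z => {w} [a b ha hb|//|u v _ IHu _ IHv|u _ IH|u v uv _ IH] z.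
- by apply: fox_comm0; apply/cls_eq1.
- by rewrite fox_cat IHu IHv.
- by rewrite fox_winv IH.
- by rewrite -(fox_feq i z uv).
Qed.

Lemma fox_Seq i u v z : Seq k.+1 u v -> fox i u z = fox i v z.
Proof.
move=> uv; have := fox_Der i z uv; rewrite fox_cat fox_winv.
have /(@clsP r k) -> : Seq k u v by apply: Seq_le uv.
by rewrite mulVKg; lia.
Qed.

(** Fox's fundamental formula, sum_i (d_i w)(x_i - 1) = w - 1. Both sides obey the same product
    rule, so single letters suffice. *)
Lemma fox_fundamental w z :
  (\sum_(i < r) (fox i w (z * (gen i)^-1)%g - fox i w z) =
   (z == cls w)%:Z - (z == 1%g)%:Z)%R.
Proof.
elim: w z => [|a w IH] z; first by rewrite cls1 subrr big1 // => i _; rewrite subrr.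
transitivity (\sum_(i < r) (fox1 i a (z * (gen i)^-1)%g - fox1 i a z) +
  \sum_(i < r) (fox i w ((cls [:: a])^-1 * z * (gen i)^-1)%g
                - fox i w ((cls [:: a])^-1 * z)%g))%R.
  by rewrite -big_split; apply: eq_bigr => i _; rewrite /= -mulgA opprD addrACA.
rewrite {}IH (cls_cons a w).
have -> : ((cls [:: a])^-1 * z == cls w) = (z == cls [:: a] * cls w).
  by rewrite -[in RHS](inj_eq (mulgI (cls [:: a])^-1)) mulKg.
have -> : ((cls [:: a])^-1 * z == 1) = (z == cls [:: a]).
  by rewrite -(mulVg (cls [:: a])) (inj_eq (mulgI _)).
suff -> : (\sum_(i < r) (fox1 i a (z * (gen i)^-1)%g - fox1 i a z) =
  (z == cls [:: a])%:Z - (z == 1%g)%:Z)%R by lia.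
rewrite (bigD1 a.1) //= big1 => [|i ne]; last first.
  by rewrite /fox1 (negbTE ne) subrr.
rewrite /fox1 eqxx addr0 /=; case: a => j b /=.
have -> : (z * (gen j)^-1 == if b then 1 else cls [:: (j, b)]) =
          (z == if b then gen j else 1).
  rewrite -[in RHS](inj_eq (mulIg (gen j)^-1)); case: b; rewrite ?mulgV ?mul1g //.
  by rewrite -cls_linv.
by case: b => /=; rewrite -/(gen j); case: eqP; case: eqP; lia.
Qed.

End Fox.

(** * The Magnus embedding *)

Section Magnus.
Variable r k : nat.
Implicit Types (u v w : fword r) (i j : 'I_r) (a : letter r).
Local Notation Q := (Sgrp r k).
Local Notation cl := (@cls r k).
Local Notation cl' := (@cls r k.+1).
Implicit Types (g h z : Q).
Local Open Scope group_scope.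

(* The path spelling [w] from [g] in the Cayley graph: an edge is named by its
   source and its generator, the boolean tells its direction of travel. *)
Fixpoint edges g w : seq ((Q * 'I_r) * bool) :=
  if w is a :: w' then
    let g' := g * cl [:: a] in
    ((if a.2 then g else g', a.1), a.2) :: edges g' w'
  else [::].

Lemma edges_fox w g z i :
  ((count_mem ((z, i), true) (edges g w))%:Z
   - (count_mem ((z, i), false) (edges g w))%:Z)%R = fox i w (g^-1 * z)%g.
Proof.
elim: w g => [|a w IH] g; first by rewrite /= subrr.
have := IH (g * cl [:: a]); rewrite invgM -mulgA /= => <-; rewrite /fox1.
have -> : (g^-1 * z == if a.2 then 1 else cl [:: a]) =
          ((if a.2 then g else g * cl [:: a]) == z).
  rewrite -(inj_eq (mulgI g)) mulVKg eq_sym.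
  by case: a.2; rewrite ?mulg1.
rewrite !xpair_eqE (eq_sym i); case: (_ == z); case: (_ == i) => /=; case: a.2 => /=; lia.
Qed.

(** Out along the representative of the source, across the edge, back along that of the target: a
    closed path, so an element of F^(k), taken modulo F^(k+1). *)
Definition loop (e : Q * 'I_r) : Sgrp r k.+1 :=
  cl' (rep e.1 ++ (e.2, true) :: winv (rep (e.1 * gen k e.2))).

Lemma cls_commute u v : Der k u -> Der k v -> commute (cl' u) (cl' v).
Proof.
move=> hu hv; apply/commgP/eqP; rewrite /commg /conjg.
by rewrite -!clsV -!clsM; apply/cls_eq1/Der_comm.
Qed.

Lemma loop_commute e e' : commute (loop e) (loop e').
Proof.
apply: cls_commute; apply/cls_eq1.
  by rewrite -cat1s !clsM clsV !repK mulgA mulgV.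
by rewrite -cat1s !clsM clsV !repK mulgA mulgV.
Qed.

Lemma loop_letter g a (g' := g * cl [:: a]) :
  (if a.2 then loop (if a.2 then g else g', a.1)
   else (loop (if a.2 then g else g', a.1))^-1)
  = cl' (rep g ++ a :: winv (rep g')).
Proof.
rewrite {}/g'; case: a => j [] //=; rewrite /loop -clsV /=.
have -> : g * cl [:: (j, false)] * gen k j = g.
  by rewrite -[[:: (j, false)]]/[:: linv (j, true)] cls_linv mulgVK.
by rewrite -(cat1s (j, true)) !winvM winvK -catA.
Qed.

(** The way back along a representative cancels the next way out along it. *)
Lemma loop_prod g w :
  cl' (rep g ++ w ++ winv (rep (g * cl w))) =
  \prod_(p <- edges g w) (if p.2 then loop p.1 else (loop p.1)^-1).
Proof.
elim: w g => [|a w IH] g.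
  by rewrite big_nil /= mulg1; apply/clsP/feq_Seq/feq_mulwV.
rewrite [edges _ _]/= big_cons -IH loop_letter (cls_cons k a w) mulgA.
rewrite -clsM -catA; apply/clsP/feq_Seq; apply: feq_cat2 => //=.
apply: (@feq_cat2 _ [:: a] [:: a]) => //; exact/feq_sym/feq_mulKw.
Qed.

(* The Fox derivatives count the net flow of the path through each edge, and
   modulo [R, R], R = F^(k), its class is the product of the commuting loops. *)
Theorem Magnus w : (forall i z, fox (k := k) i w z = 0%R) -> Der k.+1 w.
Proof.
(* The fundamental formula at [cl w] already shows that the path is closed. *)
move=> hw; have w1 : cl w = 1.
  have := fox_fundamental w (cl w).
  rewrite big1 => [|i _]; last by rewrite !hw subrr.
  by rewrite eqxx; case: eqP => // _; lia.
have := loop_prod 1 w; rewrite (prod_signed_pairs loop_commute); last first.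
  by move=> [z i]; have := edges_fox w 1 z i; rewrite hw => /eqP;
    rewrite subr_eq0 => /eqP[->].
rewrite mul1g w1 !clsM clsV mulgA => /divg1_eq h.
by apply/cls_eq1; apply: (mulgI (cl' (rep 1))); rewrite mulg1; exact: h.
Qed.

End Magnus.

Lemma Der_fox r k (w : fword r) :
  Der k.+1 w <-> forall i z, fox (k := k) i w z = 0%R.
Proof. by split=> [hw i z|]; [exact: fox_Der|exact: Magnus]. Qed.

Lemma Seq_fox r k (u v : fword r) : (cls k u = cls k v) ->
  (forall i z, fox (k := k) i u z = fox i v z) -> Seq k.+1 u v.
Proof.
move=> uv h; apply: Magnus => i z.
by rewrite fox_cat fox_winv -uv mulVKg h; lia.
Qed.

Definition wexp r (w : fword r) n := iter n (cat w) [::].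

Lemma cls_wexp r k (w : fword r) n : (cls k (wexp w n) = cls k w ^+ n)%g.
Proof. by elim: n => [|n IH]; rewrite ?expg0 // expgS -IH -clsM. Qed.

Lemma fox_wexp r k i (w : fword r) n z : cls k w = 1%g ->
  (fox (k := k) i (wexp w n) z = n%:Z * fox i w z)%R.
Proof.
move=> w1; elim: n => [|n IH]; rewrite /= ?mul0r //.
by rewrite fox_cat w1 invg1 mul1g IH; lia.
Qed.

(** By induction w lies in F^(k), where Fox derivatives are additive, so (n + 1) d_i w = 0. *)
Lemma Sgrp_torsion_free r k : torsion_free (Sgrp r k).
Proof.
move=> g n; rewrite -[g]repK; move: (rep g) => w {g}.
rewrite -cls_wexp !cls_eq1; elim: k => // k IH hw.
have w1 : Der k w by apply/IH/DerS.
apply: Magnus => i z; have := fox_Der i z hw.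
by rewrite fox_wexp; [nia|apply/cls_eq1].
Qed.

Section Exponents.
Variable r : nat.
Implicit Types (u v w : fword r) (i : 'I_r).

(** Over the trivial group F/F^(0) a Fox derivative is a single integer, the exponent sum of x_i. *)
Definition expo i w : int := fox (k := 0) i w 1%g.

Lemma Sgrp0 (g h : Sgrp r 0) : g = h.
Proof. by rewrite -[g]repK -[h]repK; apply/clsP. Qed.

Lemma expo_cat i u v : expo i (u ++ v) = (expo i u + expo i v)%R.
Proof. by rewrite /expo fox_cat (Sgrp0 (_ * 1)%g 1%g). Qed.

Lemma expo_winv i u : expo i (winv u) = (- expo i u)%R.
Proof. by rewrite /expo fox_winv (Sgrp0 (_ * 1)%g 1%g). Qed.

Lemma expo_wexp i u n : expo i (wexp u n) = (n%:Z * expo i u)%R.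
Proof. by rewrite /expo fox_wexp //; apply: Sgrp0. Qed.

Lemma expo_Der w : Der 1 w <-> forall i, expo i w = 0%R.
Proof.
rewrite Der_fox; split=> [h i|h i z]; first exact: h.
by rewrite (Sgrp0 z 1%g); apply: h.
Qed.

Lemma expo_Seq u v : Seq 1 u v <-> forall i, expo i u = expo i v.
Proof.
rewrite /Seq expo_Der; split=> h i; have := h i; rewrite /wmul expo_cat expo_winv; lia.
Qed.

Definition chi k i (g : Sgrp r k) : int := expo i (rep g).

Lemma chi_cls k i w : chi i (cls k.+1 w) = expo i w.
Proof.
suff /expo_Seq/(_ i) : Seq 1 (rep (cls k.+1 w)) w by [].
by apply: (@Seq_le _ 1 k.+1) => //; apply/clsP; rewrite repK.
Qed.

Lemma chiE k i (g h : Sgrp r k.+1) : chi i (g * h)%g = (chi i g + chi i h)%R.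
Proof.
by rewrite -[g]repK -[h]repK -clsM !chi_cls expo_cat.
Qed.

End Exponents.

(** * Endomorphisms with values in a verbally closed subgroup *)

Section Endomorphisms.
Variable r : nat.
Implicit Types (u v w x y g h q : fword r) (T : fword r -> fword r).
Implicit Types (H : fword r -> Prop).

Definition fsubst (f : 'I_r -> fword r) w :=
  flatten [seq if a.2 then f a.1 else winv (f a.1) | a : letter r <- w].

Lemma fsubst_endo f : feq_endo (fsubst f).
Proof.
have hM u v : fsubst f (u ++ v) = fsubst f u ++ fsubst f v.
  by rewrite /fsubst map_cat flatten_cat.
split=> [|u v]; last by rewrite hM.
apply: feq_ind_cong => u v a; rewrite -cat1s -(cat1s (linv a)) !hM.
apply: feq_cat2 => //; rewrite -[X in feq _ X]cat0s catA; apply: feq_cat2 => //.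
by case: a => i [] /=; rewrite /fsubst /= !cats0;
  [exact: feq_mulwV|exact: feq_mulVw].
Qed.

Lemma endo_Seq T k u v : feq_endo T -> Seq k u v -> Seq k (T u) (T v).
Proof.
move=> eT /(Der_endo eT); apply: Der_feq; apply: feq_trans (eT.2 _ _) _.
by apply: feq_cat2 => //; apply: feq_endoV.
Qed.

Lemma cls_endo_cat T k u v : feq_endo T ->
  (cls k (T (u ++ v)) = cls k (T u) * cls k (T v))%g.
Proof. by move=> eT; rewrite -clsM; apply/clsP/feq_Seq/eT.2. Qed.

Lemma cls_endo_winv T k u : feq_endo T -> (cls k (T (winv u)) = (cls k (T u))^-1)%g.
Proof. by move=> eT; rewrite -clsV; apply/clsP/feq_Seq/feq_endoV. Qed.

(** The word spelling h takes the value h at the free generators, hence also at some tuple in H; T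
    substitutes this tuple. *)
Lemma verbally_closed_endo d H h : wsubgroup H -> verbally_closed d H -> H h ->
  exists T, [/\ feq_endo T, forall w, H (T w) & Seq d (T h) h].
Proof.
move=> [H1 HM HV] vc Hh.
pose gw : fword r -> gword := foldr (fun (a : letter r) t =>
  gmul (if a.2 then gvar a.1 else ginv (gvar a.1)) t) gone.
have gwE f w : geval f (gw w) = fsubst (fun i => f i) w.
  by elim: w => //= -[i b] w /= ->; case: b.
pose f0 n : fword r := if insub n is Some i then [:: (i, true)] else [::].
have f0E w : fsubst (fun i => f0 i) w = w.
  elim: w => //= -[i b] w IH.
  rewrite -cat1s -[in RHS]IH; congr (_ ++ _).
  by rewrite /= /f0 valK; case: b.
have [|f [Hf hf]] := vc (gw h) h Hh.
  by exists f0; rewrite gwE f0E; apply: Seq_refl.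
exists (fsubst (fun i => f i)); split; first exact: fsubst_endo.
  elim=> [//|[i b] w IH]; apply: HM IH.
  by case: b; [exact: Hf|apply: HV; exact: Hf].
by rewrite -gwE.
Qed.

Lemma Gen2_subgroup d (a b : fword r) : wsubgroup (Gen2 d a b).
Proof. by split; [exact: g2_one|exact: g2_mul|exact: g2_inv]. Qed.

(* An endomorphism which is the identity modulo F^(k), and on the part of [H]
   in F^(k), restricts to an automorphism of [H], with inverse
   [t |-> t (T t)^-1 t]. *)
Lemma retract_of_unipotent k H T : wsubgroup H -> feq_endo T ->
  (forall w, H (T w)) -> (forall g, H g -> Seq k (T g) g) ->
  (forall g, H g -> Der k g -> Seq k.+1 (T g) g) -> retract k.+1 H.
Proof.
move=> [H1 HM HV] eT HT hk hk1; pose c := @cls r k.+1.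
have cM : {morph c : x y / x ++ y >-> (x * y)%g} by exact: clsM.
have cV x : c (winv x) = (c x)^-1%g by exact: clsV.
have TM x y : c (T (x ++ y)) = (c (T x) * c (T y))%g by exact: cls_endo_cat.
have TV x : c (T (winv x)) = (c (T x))^-1%g by exact: cls_endo_winv.
(* p q^-1 lies in H and in F^(k), so T fixes it modulo F^(k+1). *)
have diff p q : H p -> H q -> Seq k p q ->
    (c (T p) / c (T q) = c p / c q)%g.
  move=> Hp Hq pq; rewrite -TV -TM -cV -cM; apply/clsP/hk1; last exact: pq.
  exact: HM (HV _ Hq).
have inj p q : H p -> H q -> c (T p) = c (T q) -> c p = c q.
  move=> Hp Hq e; have /(diff p q Hp Hq) : Seq k p q.
    apply: Seq_trans (Seq_sym (hk _ Hp)) _; apply: Seq_trans (hk _ Hq).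
    by move/clsP: e; apply: Seq_le.
  by rewrite e mulgV => /esym /divg1_eq.
have TT t : H t -> c (T (T t)) = (c (T t) / c t * c (T t))%g.
  by move=> Ht; rewrite -(diff _ _ (HT t) Ht (hk _ Ht)) mulgVK.
pose th t := t ++ winv (T t) ++ t.
have Hth t : H t -> H (th t) by move=> Ht; do ?apply: (HM) => //; apply: HV.
have Tth t : H t -> c (T (th t)) = c t.
  move=> Ht; rewrite !TM TV (TT t Ht) !invgM invgK !mulgA mulgV mul1g.
  by rewrite mulgVK.
exists (fun s => th (T s)); split=> [x y /(endo_Seq eT) xy|].
  by rewrite /th; do 2?apply: Seq_cat2 => //; apply/Seq_winv/endo_Seq.
split=> [x y|].
  (* Multiplicativity is checked after applying T, which is injective on H and undoes [th]. *)
  apply/clsP; apply: inj; [exact: Hth|exact: HM (Hth _ _) (Hth _ _)|].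
  by rewrite (TM (th _)) !Tth // TM.
split=> [x|h Hh]; first exact: Hth.
apply/clsP; rewrite -/c /th !cM cV (TT h Hh) !invgM invgK !mulgA mulgV mul1g.
by rewrite mulgVK.
Qed.

Lemma endo_wexp T w n : feq_endo T -> feq (T (wexp w n)) (wexp (T w) n).
Proof.
move=> eT; elim: n => [|n IH]; first exact: feq_endo1.
by apply: feq_trans (eT.2 _ _) _; apply: feq_cat2.
Qed.

Lemma fox_conj0 k i q w z : cls k w = 1%g ->
  fox (k := k) i (q ++ w ++ winv q) z = fox i w ((cls k q)^-1 * z)%g.
Proof.
move=> w1; rewrite (derivation_conj (fox_derivation _ i)) //.
by rewrite !clsM w1 clsV mul1g mulgV invg1 mul1g; lia.
Qed.

(* [h] is (1 + M q) w in the module F^(k)/F^(k+1), with M large compared to the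
   Fox derivatives of [w]. *)
Lemma exists_rigid k w q : Der k w -> ~ Der k.+1 w -> exists M,
  let h := w ++ wexp (q ++ w ++ winv q) M in
  [/\ Der k h, ~ Der k.+1 h & forall T, feq_endo T -> Seq k.+1 (T h) h ->
      cls k (T q) = cls k q /\ Seq k.+1 (T w) w].
Proof.
move=> wk nw.
have [i [z0 vz0]] : exists i z0, fox (k := k) i w z0 <> 0%R.
  apply: contrapT => hn; apply: nw; apply: Magnus => i z.
  by apply: contrapT => nz; apply: hn; exists i, z.
have [B hB] := fsup_bound (fsup_fox k i w).
(* As |d_i w| <= B, this M exceeds 2 |d_i w| + 1, as [one_plus_rigid] requires. *)
exists (2 * B + 2)%N; set M := (2 * B + 2)%N; set h := w ++ _.
have foxM u p j z : cls k u = 1%g ->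
    fox (k := k) j (u ++ wexp (p ++ u ++ winv p) M) z =
    (fox j u z + M%:Z * fox j u ((cls k p)^-1 * z)%g)%R.
  move=> u1; rewrite fox_cat fox_wexp; last by rewrite !clsM u1 clsV mul1g mulgV.
  by rewrite fox_conj0 // u1 invg1 mul1g.
have w1 : cls k w = 1%g by apply/cls_eq1.
have hk : Der k h.
  by apply/cls_eq1; rewrite clsM cls_wexp !clsM w1 clsV !mul1g mulgV expg1n.
split=> // [hk1|T eT hT].
  apply: vz0; apply: (one_plus_inj (M := M) (q := cls k q) (fsup_fox k i w));
    first by lia.
  by move=> z; rewrite -foxM // fox_Der.
have Tw1 : cls k (T w) = 1%g by apply/cls_eq1/Der_endo.
have key j z : (fox (k := k) j (T w) z + M%:Z * fox j (T w) ((cls k (T q))^-1 * z)%g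
    = fox j w z + M%:Z * fox j w ((cls k q)^-1 * z)%g)%R.
  rewrite -!foxM // -(fox_Seq j z hT); apply: fox_feq; apply: feq_sym.
  apply: feq_trans (eT.2 _ _) _; apply: feq_cat2 => //.
  apply: feq_trans (endo_wexp _ _ eT) _; elim: (M) => //= n IH.
  apply: feq_cat2 IH; do 2 (apply: feq_trans (eT.2 _ _) _; apply: feq_cat2 => //).
  exact: feq_endoV.
have qq : cls k (T q) = cls k q.
  apply: (one_plus_rigid (@Sgrp_torsion_free r k) (fsup_fox k i w) (fsup_fox k i (T w))
    _ _ (key i)).
    by exists z0.
  by move=> z; have := hB z; rewrite /M; lia.
split=> //; apply: Seq_fox => [|j z]; first by rewrite Tw1 w1.
(* Since T q = q modulo F^(k), 1 + M q kills the difference of the derivatives of T w and w. *)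
apply/eqP; rewrite -subr_eq0; apply/eqP; move: z.
apply: (one_plus_inj (M := M) (q := cls k q)).
- by apply: fsup_sub; apply: fsup_fox.
- by rewrite /M; lia.
- by move=> z; rewrite mulrBr addrACA -opprD -key qq subrr.
Qed.

End Endomorphisms.

(** * Independent generators *)

Section IndependentPairs.
Variable r : nat.
Implicit Types (a b u v w : fword r).

(** Otherwise (u - 1) d_i v = (v - 1) d_i u, and coprimality gives d_i u = (u - 1) mu_i. By the
    fundamental formula u - 1 = (u - 1) nu with nu = sum_i mu_i (x_i - 1). So nu = 1, although nu
    has augmentation 0. *)
Lemma comm_nontrivial k u v : commute (cls k u) (cls k v) ->
  independent (cls k u) (cls k v) -> ~ Der k.+1 (wcomm u v).
Proof.
move=> cuv ind huv.
have aux (p q s t : int) : (0 = p + q - s - t -> q - s = t - p)%R by lia.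
have aux2 (p q s t : int) : (p - q - (s - t) = p - s - (q - t))%R by lia.
have aux3 (p q s t : int) : (p - q = s - t -> p - s = q - t)%R by lia.
have h i : exists mu, fsup mu /\
    forall z, (fox i u z = mu ((cls k u)^-1 * z)%g - mu z)%R.
  have [|mu [fmu _ hmu]] :=
    coprime_factor cuv ind (fsup_fox k i v) (fsup_fox k i u).
    move=> z; apply: aux; rewrite -(derivation_comm (fox_derivation k i)) //.
    by rewrite fox_Der.
  by exists mu.
have {h} [mu hmu] := choice h.
have [s hs] := choice (fun i => (hmu i).1).
(* S contains 1, the supports of all mu_i and their right translates by x_i. *)
pose S := undup (1%g :: flatten
  [seq s i ++ [seq z * gen k i | z <- s i]%g | i <- enum 'I_r]).
have hS i z : mu i z <> 0%R -> z \in S /\ (z * gen k i)%g \in S.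
  have iE : s i ++ [seq z * gen k i | z <- s i]%g \in
      [seq s i ++ [seq z * gen k i | z <- s i]%g | i <- enum 'I_r].
    by apply/mapP; exists i; rewrite ?mem_enum.
  move=> /(hs i) zs; rewrite !mem_undup !inE; split; apply/orP; right;
    apply/flattenP; eexists; (try exact: iE); rewrite mem_cat ?zs //.
  by apply/orP; right; apply: (map_f (fun z => z * gen k i)%g).
pose nu z := (\sum_(i < r) (mu i (z * (gen k i)^-1)%g - mu i z))%R.
have nuE z : (nu z = (z == 1%g)%:Z)%R.
  apply/eqP; rewrite -subr_eq0; apply/eqP; move: z.
  have u1 : infinite_order (cls k u).
    by move=> m n e; have [] := ind m 0%N n 0%N; rewrite ?mulg1.
  apply: (shiftV_invariant0 _ u1).
    apply: fsup_sub; last first.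
      by exists [:: 1%g] => z; rewrite inE; case: eqP.
    exists S => z nz; apply: contrapT => zS; apply: nz.
    apply: big1 => i _; have m0 y : ~ (y \in S /\ (y * gen k i)%g \in S) -> mu i y = 0%R.
      by move=> ny; apply: contrapT => /hS.
    by rewrite !m0 ?mulgVK => [//|[]|[]].
  move=> z; have := fox_fundamental u z.
  rewrite (eq_bigr (fun i => (mu i ((cls k u)^-1 * z * (gen k i)^-1)%g
     - mu i ((cls k u)^-1 * z)%g) - (mu i (z * (gen k i)^-1)%g - mu i z))%R); last first.
    by move=> i _; rewrite !(hmu i).2 mulgA; apply: aux2.
  rewrite sumrB -/(nu _) -/(nu z).
  have -> : ((cls k u)^-1 * z == 1)%g = (z == cls k u).
    by rewrite -(mulVg (cls k u)) (inj_eq (mulgI _)).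
  exact: aux3.
have : (\sum_(z <- S) nu z = 0)%R.
  rewrite /nu exchange_big big1 // => i _.
  by apply: fsup_total_shift; [exact: undup_uniq|exact: hS].
rewrite (eq_bigr _ (fun z _ => nuE z)).
have -> : (\sum_(z <- S) (z == 1%g)%:Z = 1)%R.
  rewrite (bigD1_seq 1%g) ?undup_uniq //= ?mem_undup ?inE ?eqxx //.
  by rewrite big1 // => z /negbTE ->.
by [].
Qed.

Lemma shift_scale0 (Q : groupType) (v : Q -> int) (a : Q) (i j : int) :
  fsup v -> infinite_order a -> (exists z, v z <> 0%R) ->
  (forall z, i * v z = j * v (a^-1 * z)%g)%R -> i = 0%R /\ j = 0%R.
Proof.
move=> fv oa [z vz] h.
have i0 : i = 0%R.
  apply: contrapT => ni.
  have oV : infinite_order a^-1%g.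
    by move=> m n; rewrite !expVgn => /invg_inj /oa.
  have [n] := fsup_escape z fv oV; elim: n => [|n IH]; first by rewrite mul1g.
  move=> e; apply: IH; move: e; rewrite expgS -mulgA => e.
  by have := h (a^-1 ^+ n * z)%g; rewrite e mulr0 => /eqP;
    rewrite mulf_eq0 => /orP[/eqP|/eqP].
split=> //; have := h (a * z)%g; rewrite i0 mul0r mulKg => /esym/eqP.
by rewrite mulf_eq0 => /orP[/eqP|/eqP].
Qed.

(** The derivatives of w^p (a w a^-1)^q are (p + q a) d_i w, and these determine p and q. *)
Lemma independent_conj k a w : infinite_order (cls k a) -> Der k w -> ~ Der k.+1 w ->
  independent (cls k.+1 w) (cls k.+1 (a ++ w ++ winv a)).
Proof.
move=> oa wk nw m n m' n'; rewrite -!cls_wexp -!clsM => /clsP e.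
have w1 : cls k w = 1%g by apply/cls_eq1.
have E p q i z : (fox (k := k) i (wexp w p ++ wexp (a ++ w ++ winv a) q) z =
    p%:Z * fox i w z + q%:Z * fox i w ((cls k a)^-1 * z)%g)%R.
  rewrite fox_cat cls_wexp w1 expg1n invg1 mul1g !fox_wexp ?fox_conj0 //.
  by rewrite !clsM w1 clsV mul1g mulgV.
have [i [z0 vz0]] : exists i z0, fox (k := k) i w z0 <> 0%R.
  apply: contrapT => hn; apply: nw; apply: Magnus => i z.
  by apply: contrapT => nz; apply: hn; exists i, z.
have [||] := @shift_scale0 _ _ _ (m%:Z - m'%:Z)%R (n'%:Z - n%:Z)%R (fsup_fox k i w) oa.
- by exists z0.
- by move=> z; have := fox_Seq i z e; rewrite !E !mulrBl; set x := fox _ _ _;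
  set y := fox _ _ _; lia.
- by lia.
Qed.

Fixpoint tower a u n : fword r :=
  if n is n'.+1 then
    let x := tower a u n' in wcomm x (a ++ x ++ winv a)
  else u.

Lemma tower_Der a u n : Der 1 u -> Der n.+1 (tower a u n).
Proof.
by move=> hu; elim: n => [//|n IH]; apply: ds_comm (IH) (Der_conj _ IH).
Qed.

Lemma tower_subgroup (H : fword r -> Prop) a u n :
  wsubgroup H -> H a -> H u -> H (tower a u n).
Proof.
move=> [H1 HM HV] Ha Hu; elim: n => //= n IH.
have Hc : H (a ++ tower a u n ++ winv a) by apply/HM/HM => //; apply: HV.
by apply: HM (HV _ IH) (HM _ _ (HV _ Hc) (HM _ _ IH Hc)).
Qed.

Lemma expo_order k i a : expo i a <> 0%R -> infinite_order (cls k.+1 a).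
Proof.
move=> ai; apply: (@chi_order _ (@chi r k.+1 i) (@chiE r k i)).
by rewrite chi_cls.
Qed.

(** If x_j is nontrivial in its layer, then x_j and a x_j a^-1 are independent in the next quotient,
    so their commutator is nontrivial one layer deeper. *)
Lemma tower_nontrivial a u n i : expo i a <> 0%R -> Der 1 u -> ~ Der 2 u ->
  ~ Der n.+2 (tower a u n).
Proof.
move=> ai u1 u2; elim: n => [//|n IH]; apply: comm_nontrivial.
  by apply: cls_commute; last apply: Der_conj; apply: tower_Der.
by apply: independent_conj => //; [exact: expo_order ai|exact: tower_Der].
Qed.

Lemma tower_independent a u n i : expo i a <> 0%R -> Der 1 u -> ~ Der 2 u ->
  independent (cls n.+2 (tower a u n)) (cls n.+2 (a ++ tower a u n ++ winv a)).
Proof.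
move=> ai u1 u2; apply: independent_conj; first exact: expo_order ai.
  exact: tower_Der.
exact: tower_nontrivial ai u1 u2.
Qed.

(** The subtracted map u -> (u - 1) mu is the inner derivation given by mu. *)
Lemma derivation_sub_inner k K (E : fword r -> Sgrp r k -> int) (mu : Sgrp r k -> int) :
  derivation K E ->
  derivation K (fun u z => E u z - (mu ((cls k u)^-1 * z)%g - mu z))%R.
Proof.
move=> [sK Ef EM]; split=> // [u v z uv|u v z Ku Kv].
  by rewrite (Ef _ _ _ uv) (_ : cls k u = cls k v) //; apply/clsP/feq_Seq.
rewrite EM // clsM invgM -mulgA.
have aux (p q s t x : int) : (p + q - (s - t) = p - (x - t) + (q - (s - x)))%R by lia.
exact: aux.
Qed.

(** * Derivations vanishing along the tower *)

Section Descent.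
Variables (k : nat) (K : fword r -> Prop) (E : fword r -> Sgrp r k.+1 -> int).
Hypotheses (dE : derivation K E) (fE : forall u, K u -> fsup (E u)).

(** With y = a x a^-1, the rule for conjugates leaves (1 - y) E a = 0. *)
Lemma derivation_conj0 a x : K a -> K x -> infinite_order (cls k.+1 (a ++ x ++ winv a)) ->
  (forall z, E x z = 0%R) -> (forall z, E (a ++ x ++ winv a) z = 0%R) ->
  forall z, E a z = 0%R.
Proof.
move=> Ka Kx oy x0 y0; apply: (shiftV_invariant0 (fE Ka) oy) => z.
have := y0 z; rewrite (derivation_conj dE) // x0 addr0 => /eqP.
by rewrite subr_eq0 => /eqP.
Qed.

(** Since E a = 0, E y = a E x for y = a x a^-1, and the commutator rule becomes (1 - y + x a - a) E
    x = 0. The exponent sum of x_i is the grading. *)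
Lemma derivation_descent i a x : K a -> K x -> expo i a <> 0%R -> Der 1 x ->
  infinite_order (cls k.+1 (a ++ x ++ winv a)) ->
  (forall z, E a z = 0%R) -> (forall z, E (wcomm x (a ++ x ++ winv a)) z = 0%R) ->
  forall z, E x z = 0%R.
Proof.
move=> Ka Kx ai x1 oy a0 c0.
have [[K1 KM KV] Ef EM] := dE.
have Ky : K (a ++ x ++ winv a) by apply/KM/KM => //; apply: KV.
have yE z : E (a ++ x ++ winv a) z = E x ((cls k.+1 a)^-1 * z)%g.
  by rewrite (derivation_conj dE) // !a0 subr0 add0r.
apply: (@graded_inj_neq _ (@chi r k.+1 i) (cls k.+1 x) _ (cls k.+1 a) _ _ _ _ _ oy (fE
  Kx)).
- exact: chiE.
- by rewrite chi_cls.
- by rewrite chi_cls; exact: (expo_Der _).1.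
- by rewrite chi_cls; exact: (expo_Der _).1 (Der_conj _ x1) _.
move=> z; have := derivation_comm dE z Kx Ky; rewrite c0 !yE.
have aux (p q s t : int) : (0 = p + q - s - t -> p - t + q - s = 0)%R by lia.
exact: aux.
Qed.

Lemma derivation_descent0 a b : K a -> K b -> infinite_order (cls k.+1 a) ->
  (forall z, E a z = 0%R) -> (forall z, E (wcomm a b) z = 0%R) ->
  forall z, E b z = 0%R.
Proof.
move=> Ka Kb oa a0 c0; apply: (shiftV_invariant0 (fE Kb) oa) => z.
have := derivation_comm dE z Ka Kb; rewrite c0 !a0 subr0 add0r => /esym/eqP.
by rewrite subr_eq0 => /eqP.
Qed.

End Descent.

(* A derivation killing the tower is inner: it is inner on two independent
   commuting elements, and being zero propagates down the tower. *)
Lemma tower_inner m K (E : fword r -> Sgrp r m.+1 -> int) a b i :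
  derivation K E -> (forall u, K u -> fsup (E u)) -> K a -> K b ->
  expo i a <> 0%R -> independent (cls 1 a) (cls 1 b) ->
  (forall z, E (tower a (wcomm a b) m) z = 0%R) ->
  exists mu, [/\ fsup mu, forall z, (E a z = mu ((cls m.+1 a)^-1 * z)%g - mu z)%R
    & forall z, (E b z = mu ((cls m.+1 b)^-1 * z)%g - mu z)%R].
Proof.
have aux (p q s t : int) : (0 = p + q - s - t -> q - s = t - p)%R by lia.
have aux0 (p q : int) : (p - q = 0 -> p = q)%R by lia.
move=> dE fE Ka Kb ai ind; have [[K1 KM KV] _ _] := dE.
have u1 : Der 1 (wcomm a b) by apply: ds_comm.
have cab : commute (cls 1 a) (cls 1 b) by apply: cls_commute.
have u2 := comm_nontrivial cab ind.
(* For m = 0 the commuting pair is [a], [b] itself. *)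
case: m E dE fE => [|m] E dE fE hE.
  have [|mu [fmu hb ha]] := coprime_factor cab ind (fE _ Kb) (fE _ Ka).
    by move=> z; apply: aux;
      rewrite -(derivation_comm dE) // [wcomm a b]/(tower a _ 0) hE.
  by exists mu.
have Kt n : K (tower a (wcomm a b) n).
  by apply: tower_subgroup => //; exact: KM (KV _ Ka) (KM _ _ (KV _ Kb) (KM _ _ Ka Kb)).
have Ky n : K (a ++ tower a (wcomm a b) n ++ winv a) by apply/KM/KM => //; apply: KV.
pose x := tower a (wcomm a b) m; pose y := a ++ x ++ winv a.
have cxy : commute (cls m.+2 x) (cls m.+2 y).
  by apply: cls_commute; [|apply: Der_conj]; apply: tower_Der.
have [|mu [fmu hy hx]] := coprime_factor cxy (tower_independent ai u1 u2) (fE _ (Ky m))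
  (fE _ (Kt m)).
  by move=> z; apply: aux; rewrite -(derivation_comm dE) // -/(wcomm x y); apply/esym/hE.
(* Without its inner part E vanishes on x and y, hence on a, then down the tower to [a, b], and
   finally on b. *)
pose E' u z := (E u z - (mu ((cls m.+2 u)^-1 * z)%g - mu z))%R.
have dE' : derivation K E' by apply: derivation_sub_inner.
have fE' u : K u -> fsup (E' u).
  by move=> Ku; do 2?apply: fsup_sub => //; [exact: fE|exact: fsup_tr].
have oy n : (n <= m)%N -> infinite_order (cls m.+2 (a ++ tower a (wcomm a b) n ++ winv
  a)).
  move=> nm; apply: torsion_free_order; first exact: Sgrp_torsion_free.
  rewrite !clsM clsV => e; apply: (tower_nontrivial ai u1 u2 (n := n)).
  apply: (@Der_le _ _ m.+2) => //; apply/cls_eq1.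
  by move: e; rewrite mulgA => /divg1_eq; rewrite -[X in _ = X]mulg1 => /mulgI.
have x0 z : E' x z = 0%R by rewrite /E' hx subrr.
have a0 : forall z, E' a z = 0%R.
  apply: (derivation_conj0 dE' fE' Ka (Kt m) (oy m (leqnn m)) x0) => z.
  by rewrite /E' hy subrr.
have t0 n : (n <= m)%N -> forall z, E' (tower a (wcomm a b) (m - n)) z = 0%R.
  elim: n => [|n IH] nm; first by rewrite subn0.
  have mn : (m - n = (m - n.+1).+1)%N by lia.
  apply: (derivation_descent dE' fE' Ka (Kt _) ai _ _ a0).
  - by apply: (@Der_le _ _ (m - n.+1).+1) => //; apply: tower_Der.
  - by apply: oy; lia.
  - by move: (IH (ltnW nm)); rewrite mn.
have b0 : forall z, E' b z = 0%R.
  apply: (derivation_descent0 dE' fE' Ka Kb (@expo_order _ i _ ai) a0).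
  by have := t0 m (leqnn m); rewrite subnn.
by exists mu; split=> // z; apply: aux0; [exact: a0|exact: b0].
Qed.

End IndependentPairs.

Theorem retract_rank2 r m (a b : fword r) :
  (forall i j : int, (forall l, i * expo l a + j * expo l b = 0)%R -> i = 0%R /\ j =
    0%R) ->
  verbally_closed m.+2 (Gen2 m.+2 a b) -> retract m.+2 (Gen2 m.+2 a b).
Proof.
move=> ind vc; set H := Gen2 _ a b in vc *.
have sH : wsubgroup H by apply: Gen2_subgroup.
have [H1 HM HV] := sH.
have Ha : H a by apply: g2_a.
have Hb : H b by apply: g2_b.
have [l al] : exists l, expo l a <> 0%R.
  apply: contrapT => hn; have [|//] := ind 1%R 0%R.
  move=> l; rewrite mul0r mul1r addr0; apply: contrapT => al; apply: hn; by exists l.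
have ind1 : independent (cls 1 a) (cls 1 b).
  move=> p q p' q'; rewrite -!cls_wexp -!clsM => /clsP/expo_Seq e.
  have [|e1 e2] := ind (p%:Z - p'%:Z)%R (q%:Z - q'%:Z)%R; last by lia.
  by move=> i; have := e i; rewrite !expo_cat !expo_wexp; lia.
have u1 : Der 1 (wcomm a b) by apply: ds_comm.
have cab : commute (cls 1 a) (cls 1 b) by apply: cls_commute.
have u2 := comm_nontrivial cab ind1.
pose n := tower a (wcomm a b) m.
have Hn : H n by apply: tower_subgroup => //;
  exact: HM (HV _ Ha) (HM _ _ (HV _ Hb) (HM _ _ Ha Hb)).
have Hx w q M : H w -> H q -> H (w ++ wexp (q ++ w ++ winv q) M).
  move=> Hw Hq; apply: (HM) => //; elim: M => //= M IH; apply: (HM) IH.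
  exact: HM (HM _ _ Hw (HV _ Hq)).
(* First the tower element with q = b, then the resulting element with q = a: fixing the outer
   element makes T fix the inner ones. *)
have [M2 [h2k nh2 hM2]] := exists_rigid b (@tower_Der _ a _ m u1) (@tower_nontrivial _
  a _ m l al u1 u2).
have [M1 [_ _ hM1]] := exists_rigid a h2k nh2.
have [T [eT HT Th]] := verbally_closed_endo sH vc (Hx _ _ M1 (Hx _ _ M2 Hn Hb) Ha).
have [Ta Th2] := hM1 T eT Th; have [Tb Tn] := hM2 T eT Th2.
have hT g : H g -> cls m.+1 (T g) = cls m.+1 g.
  elim=> {g} [//|//||x y _ hx _ hy|x _ hx|x y xy _ hx].
  - by apply/clsP/feq_Seq/feq_endo1.
  - by rewrite /wmul cls_endo_cat // clsM hx hy.
  - by rewrite cls_endo_winv // clsV hx.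
  - have xy' : Seq m.+1 x y by apply: Seq_le xy.
    by have /clsP <- := xy'; rewrite -hx; apply/clsP/Seq_sym/endo_Seq.
(* As T g = g modulo F^(m+1) for g in H, these are the Fox derivatives of (T g) g^-1. *)
pose E i u (z : Sgrp r m.+1) := (fox i (T u) z - fox i u z)%R.
have dE i : derivation H (E i).
  split=> // [u v z uv|u v z Hu Hv]; rewrite /E.
    by rewrite (fox_feq _ _ uv) (fox_feq _ _ (eT.1 _ _ uv)).
  rewrite (fox_feq _ _ (eT.2 u v)) !fox_cat hT //.
  have aux (p q s t : int) : (p + q - (s + t) = p - s + (q - t))%R by lia.
  exact: aux.
have fE i u : H u -> fsup (E i u) by move=> _; apply: fsup_sub; apply: fsup_fox.
have inner i : exists mu, [/\ fsup mu, forall z, (E i a z = mu ((cls m.+1 a)^-1 * z)%g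
  - mu z)%R
    & forall z, (E i b z = mu ((cls m.+1 b)^-1 * z)%g - mu z)%R].
  apply: (tower_inner (dE i) (fE i) Ha Hb al ind1) => z.
  by rewrite /E (fox_Seq _ _ Tn) subrr.
(* An inner derivation (g - 1) mu vanishes where g is trivial in F/F^(m+1). *)
have innerH i g : H g -> cls m.+1 g = 1%g -> forall z, E i g z = 0%R.
  have [mu [fmu ha hb]] := inner i.
  have [_ Ef EM] := derivation_sub_inner mu (dE i).
  have dE' := derivation_sub_inner mu (dE i).
  move=> Hg g1 z; suff : (E i g z - (mu ((cls m.+1 g)^-1 * z)%g - mu z) = 0)%R.
    by rewrite g1 invg1 mul1g; lia.
  elim: Hg z {g1} => {g} [z|z|z|x y Hx' hx Hy hy z|x Hx' hx z|x y xy Hx' hx z].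
  - by rewrite ha subrr.
  - by rewrite hb subrr.
  - exact: (derivation1 dE' z).
  - by rewrite EM // hx hy.
  - by rewrite (derivation_winv dE') // hx.
  - have xy' : Seq m.+1 x y by apply: Seq_le xy.
    rewrite -(hx z) /E (fox_Seq _ _ xy) (fox_Seq _ _ (endo_Seq eT xy)).
    by have /clsP -> := xy'.
apply: (retract_of_unipotent sH eT HT) => [g Hg|g Hg gk]; first exact/clsP/hT.
apply: Seq_fox => [|i z]; first exact: hT.
have aux (p q : int) : (p - q = 0 -> p = q)%R by lia.
by apply: aux; apply: (innerH i g Hg); apply/cls_eq1.
Qed.

(** * Cyclic image in the abelianization *)

Section IntegerPowers.
Variable r : nat.
Implicit Types (c u v w : fword r) (t : int).

Definition zexp w t := match t with Posz n => wexp w n | Negz n => wexp (winv w) n.+1 end.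

Lemma wexp_subgroup (H : fword r -> Prop) w n : wsubgroup H -> H w -> H (wexp w n).
Proof. by move=> [H1 HM _] Hw; elim: n => //= n IH; apply: HM. Qed.

Lemma zexp_subgroup (H : fword r -> Prop) w t : wsubgroup H -> H w -> H (zexp w t).
Proof.
move=> sH Hw; case: t => n; apply: wexp_subgroup => //.
by case: sH => _ _ HV; apply: HV.
Qed.

Lemma expo_zexp i w t : (expo i (zexp w t) = t * expo i w)%R.
Proof. by case: t => n; rewrite /zexp expo_wexp ?expo_winv; lia. Qed.

Lemma zexp_commute k c s t : commute (cls k (zexp c s)) (cls k (zexp c t)).
Proof.
have cX m n : commute (cls k c ^+ m)%g (cls k c ^+ n)%g.
  exact/commuteX2/commute_refl.
case: s => m; case: t => n; rewrite /zexp !cls_wexp ?clsV ?expVgn //.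
- exact: commuteV.
- exact/commute_sym/commuteV.
- by apply: commuteV; apply/commute_sym/commuteV.
Qed.

Lemma feq_wexp u v n : feq u v -> feq (wexp u n) (wexp v n).
Proof. by move=> uv; elim: n => //= n IH; apply: feq_cat2. Qed.

Lemma endo_zexp T w t : feq_endo T -> feq (T (zexp w t)) (zexp (T w) t).
Proof.
move=> eT; case: t => n; rewrite /zexp; first exact: endo_wexp.
apply: feq_trans (endo_wexp _ _ eT) _; exact/feq_wexp/feq_endoV.
Qed.

Lemma cls_zexp k u v t : cls k u = cls k v -> cls k (zexp u t) = cls k (zexp v t).
Proof. by move=> uv; case: t => n; rewrite /zexp !cls_wexp ?clsV uv. Qed.

End IntegerPowers.

Lemma abelian_Sgrp1 r (g h : Sgrp r 1) : commute g h.
Proof. by rewrite -[g]repK -[h]repK; apply: cls_commute. Qed.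

Section CyclicImage.
Variables (r : nat) (H : fword r -> Prop) (c : fword r).
Hypotheses (sH : wsubgroup H) (Hc : H c).
Hypothesis cyc : forall u, H u -> exists t : int, forall l, (expo l u = t * expo l c)%R.
Implicit Types (u v w : fword r) (f : 'I_r -> Sgrp r 1 -> int).
Local Notation cl := (@cls r 1).
Local Open Scope ring_scope.

Lemma cyclic_decomp u : H u -> exists t v,
  [/\ H v, Der 1 v & feq u (v ++ zexp c t)].
Proof.
move=> Hu; have [t ht] := cyc Hu; have [H1 HM HV] := sH.
exists t, (u ++ winv (zexp c t)); split.
- exact: HM _ _ Hu (HV _ (zexp_subgroup t sH Hc)).
- by apply/expo_Der => l; rewrite expo_cat expo_winv expo_zexp ht; lia.
- rewrite -catA -[X in feq X _]cats0; apply: feq_cat2 => //.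
  exact/feq_sym/feq_mulVw.
Qed.

(* The image of multiplication by [c - 1] on the module of H cap F'. *)
Definition augim f := exists v, [/\ H v, Der 1 v &
  forall i z, f i z = fox i v ((cl c)^-1 * z)%g - fox i v z].

Lemma augim_ext f f' : (forall i z, f i z = f' i z) -> augim f -> augim f'.
Proof. by move=> h [v [Hv v1 hv]]; exists v; split=> // i z; rewrite -h. Qed.

Lemma augim0 : augim (fun _ _ => 0).
Proof. by case: sH => H1 _ _; exists [::]; split=> //; exact: Der_one. Qed.

Lemma augim_add f f' : augim f -> augim f' -> augim (fun i z => f i z + f' i z).
Proof.
have [H1 HM HV] := sH.
move=> [v [Hv v1 hv]] [v' [Hv' v1' hv']]; exists (v ++ v').
split=> [||i z]; [exact: HM|exact: Der_mul|].
rewrite !fox_cat hv hv' (proj2 (@cls_eq1 r 1 v)) // invg1 !mul1g.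
by rewrite opprD addrACA.
Qed.

Lemma augim_opp f : augim f -> augim (fun i z => - f i z).
Proof.
have [H1 HM HV] := sH.
move=> [v [Hv v1 hv]]; exists (winv v).
split=> [||i z]; [exact: HV|exact: Der_inv|].
rewrite !fox_winv hv (proj2 (@cls_eq1 r 1 v)) // !mul1g.
by rewrite opprD.
Qed.

(** Conjugating v by u translates its derivatives by u, and Z[Z^r] is commutative. *)
Lemma augim_tr f u : H u -> augim f -> augim (fun i z => f i ((cl u)^-1 * z)%g).
Proof.
have [H1 HM HV] := sH.
move=> Hu [v [Hv v1 hv]]; exists (u ++ v ++ winv u).
split=> [||i z]; [exact: HM (HM _ _ Hv (HV _ Hu))|exact: Der_conj|].
have v1' : cl v = 1%g by apply/cls_eq1.
by rewrite !fox_conj0 // hv !mulgA (abelian_Sgrp1 (cl u)^-1%g (cl c)^-1%g).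
Qed.

Lemma augim_wexp n v : H v -> Der 1 v ->
  augim (fun i z => fox i v ((cl (wexp c n))^-1 * z)%g - fox i v z).
Proof.
move=> Hv v1; elim: n => [|n IH].
  by apply: augim_ext augim0 => i z; rewrite invg1 mul1g subrr.
have h : augim (fun i z => fox i v ((cl c)^-1 * z)%g - fox i v z) by exists v.
(* c^(n+1) - 1 = (c - 1) + c (c^n - 1). *)
apply: augim_ext (augim_add h (augim_tr Hc IH)) => i z.
rewrite -[wexp c n.+1]/(c ++ wexp c n) clsM invgM -!mulgA.
have aux (p q s : int) : p - q + (s - p) = s - q by lia.
exact: aux.
Qed.

Lemma augim_zexp t v : H v -> Der 1 v ->
  augim (fun i z => fox i v ((cl (zexp c t))^-1 * z)%g - fox i v z).
Proof.
move=> Hv v1; case: t => n; first exact: augim_wexp.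
have [_ _ HV] := sH.
have Hn := HV _ (wexp_subgroup n.+1 sH Hc).
apply: augim_ext (augim_opp (augim_tr Hn (augim_wexp n.+1 Hv v1))) => i z.
rewrite /zexp !cls_wexp !clsV cls_wexp expVgn !invgK mulKg opprB.
by [].
Qed.

Lemma augim_scale u v : H u -> H v -> Der 1 v ->
  augim (fun i z => fox i v ((cl u)^-1 * z)%g - fox i v z).
Proof.
move=> Hu Hv v1; have [t [w [_ w1 uE]]] := cyclic_decomp Hu.
apply: augim_ext (augim_zexp t Hv v1) => i z; congr (fox i v (_^-1 * z)%g - _).
have -> : cl u = cl (w ++ zexp c t) by apply/clsP/feq_Seq.
by rewrite clsM (proj2 (@cls_eq1 r 1 w)) // mul1g.
Qed.

(** Write u = p c^s, v = q c^t with p, q in F'. As [c^s, c^t] = 1, the powers of c contribute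
    nothing to the commutator rule, which leaves (1 - v) d_i p + (u - 1) d_i q. *)
Lemma augim_comm u v : H u -> H v -> augim (fun i z => fox i (wcomm u v) z).
Proof.
have [H1 HM HV] := sH.
move=> Hu Hv; have [s [p [Hp p1 uE]]] := cyclic_decomp Hu.
have [t [q [Hq q1 vE]]] := cyclic_decomp Hv.
apply: augim_ext (augim_tr (HV _ (HM _ _ Hv Hu)) (augim_add
  (augim_opp (augim_scale Hv Hp p1)) (augim_scale Hu Hq q1))) => i z.
rewrite clsV invgK.
have cp : cl p = 1%g by apply/cls_eq1.
have cq : cl q = 1%g by apply/cls_eq1.
have cuE : cl u = cl (zexp c s).
  by rewrite -[RHS]mul1g -cp -clsM; apply/clsP/feq_Seq.
have cvE : cl v = cl (zexp c t).
  by rewrite -[RHS]mul1g -cq -clsM; apply/clsP/feq_Seq.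
set y := (_ * z)%g; have zE : z = ((cl v * cl u)^-1 * y)%g by rewrite /y -clsM mulKg.
rewrite [z in RHS]zE (derivation_comm (fox_derivation 1 i)) //.
have fu (x : Sgrp r 1) : fox i u x = fox i p x + fox i (zexp c s) x.
  by rewrite (fox_feq i x uE) fox_cat cp invg1 mul1g.
have fv (x : Sgrp r 1) : fox i v x = fox i q x + fox i (zexp c t) x.
  by rewrite (fox_feq i x vE) fox_cat cq invg1 mul1g.
have h0 : 0 = fox i (zexp c s) y + fox i (zexp c t) ((cl u)^-1 * y)%g
    - fox i (zexp c t) y - fox i (zexp c s) ((cl v)^-1 * y)%g.
  rewrite cuE cvE -(derivation_comm (fox_derivation 1 i)) //.
  rewrite fox_Der //; apply/cls_eq1; rewrite !clsM !clsV.
  by have /commgP/eqP := zexp_commute 2 c s t.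
rewrite !fu !fv.
move: (fox i (zexp c s) y) (fox i (zexp c t) y) h0 => ? ?.
move: (fox i (zexp c t) _) (fox i (zexp c s) _) => ? ?.
move: (fox i p y) (fox i q y) (fox i p _) (fox i q _) => ? ? ? ?; lia.
Qed.

Lemma augim_DerSucc w : DerSucc H w -> augim (fun i z => fox i w z).
Proof.
have [H1 HM HV] := sH.
have d1 x : DerSucc H x -> cl x = 1%g.
  by move=> hx; apply/cls_eq1; apply: (dser_mono (k := 1)) hx.
elim=> {w} [u v Hu Hv||x y hx0 hx hy0 hy|x hx0 hx|x y xy _ hx].
- exact: augim_comm.
- exact: augim0.
- apply: augim_ext (augim_add hx hy) => i z.
  by rewrite fox_cat d1 // invg1 mul1g.
- by apply: augim_ext (augim_opp hx) => i z; rewrite fox_winv d1 // mul1g.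
- by apply: augim_ext hx => i z; apply: fox_feq.
Qed.

End CyclicImage.

Section CyclicRetract.
Variables (r m : nat) (H : fword r -> Prop) (c : fword r).
Hypotheses (sH : wsubgroup H) (Hc : H c).
Hypothesis Heq : forall x y, Seq m.+2 x y -> H x -> H y.
Hypothesis cyc : forall u, H u -> exists t : int, forall l, (expo l u = t * expo l c)%R.
Hypothesis vc : verbally_closed m.+2 H.

(** The endomorphism fixing g has values in H, so it carries F^(j) into the j-th derived subgroup of
    H. *)
Lemma verbally_closed_dser j g : H g -> Der j g ->
  exists2 g', dser j H g' & Seq m.+2 g' g.
Proof.
move=> Hg gj; have [T [eT HT Tg]] := verbally_closed_endo sH vc Hg.
by exists (T g) => //; move: gj; rewrite Der_dser; apply: dser_endo.
Qed.

Lemma DerSucc_sub g : DerSucc H g -> H g.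
Proof.
have [H1 HM HV] := sH.
elim=> {g} [u v Hu Hv|//|x y _ + _|x _|x y xy _]; [|exact: HM|exact: HV|].
  exact: HM (HV _ Hu) (HM _ _ (HV _ Hv) (HM _ _ Hu Hv)).
exact/Heq/feq_Seq.
Qed.

Lemma cyclic_Der2 g : H g -> Der 1 g -> Der 2 g.
Proof.
(* If all exponent sums of c vanish, H lies in F', and g equals in S an element of [H, H], which
   lies in F''. *)
have [[l cl0]|c0] := pselect (exists l, expo l c <> 0%R); last first.
  have H1 u : H u -> Der 1 u.
    move=> /cyc[t ht]; apply/expo_Der => l; rewrite ht.
    suff -> : expo l c = 0%R by rewrite mulr0.
    by apply: contrapT => cl0; apply: c0; exists l.
  move=> Hg g1; have [g' hg' gg'] := verbally_closed_dser Hg g1.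
  apply: (Seq_Der (v := g')); first by apply/Seq_sym/(@Seq_le _ _ m.+2).
  by apply: (dser_mono (k := 1) H1) hg'.
have step u : H u -> Der 1 u -> augim H c (fun i z => fox i u z).
  move=> Hu u1; have [u' hu' uu'] := verbally_closed_dser Hu u1.
  apply: augim_ext (augim_DerSucc sH Hc cyc hu') => i z; apply: fox_Seq.
  exact: (@Seq_le _ _ m.+2).
have [ch [chM ch0]] : exists ch : Sgrp r 1 -> int,
    (forall x y, ch (x * y)%g = ch x + ch y)%R /\ (0 < ch (cls 1 c))%R.
  have [lt0|le0] := ltP 0%R (expo l c).
    by exists (@chi r 1 l); split; [exact: chiE|rewrite chi_cls].
  exists (fun x => - chi l x)%R; split=> [x y|]; last by rewrite chi_cls; lia.
  by rewrite chiE opprD.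
move=> Hg g1; apply: Magnus => i.
have [L hL] := fsup_chi_bound ch (fsup_fox 1 i g).
(* Each division by c - 1 shortens the window of degrees by one, until it is empty. *)
have main (n : nat) a u : H u -> Der 1 u ->
    (forall z, fox (k := 1) i u z <> 0 -> a <= ch z < a + n%:Z)%R ->
    forall z, fox (k := 1) i u z = 0%R.
  elim: n u => [|n IH] u Hu u1 hu z.
    by apply: contrapT => /hu; lia.
  have [v [Hv v1 hv]] := step u Hu u1.
  have v0 := IH v Hv v1 (width_shrink chM ch0 (fsup_fox 1 i v) (fun z => esym (hv i z))
    hu).
  by rewrite hv !v0.
apply: (main (L + L)%N (- L%:Z)%R) => // z /hL; lia.
Qed.

(** As g is in F'', it equals in S an element of [H', H'], where H' = [H, H] is already one step
    higher in the series by induction. *)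
Lemma cyclic_Der j g : H g -> Der 1 g -> (j <= m.+2)%N -> Der j g.
Proof.
elim: j g => [|[|[|j]] IH] g Hg g1 hj //; first exact: cyclic_Der2.
have [g' hg' gg'] := verbally_closed_dser Hg (cyclic_Der2 Hg g1).
apply: (Seq_Der (v := g')); first by apply/Seq_sym/(@Seq_le _ _ m.+2).
apply: (dser_mono (k := 1) (P := DerSucc H)) hg' => u hu.
apply: IH; [exact: DerSucc_sub| |exact: ltnW].
by apply: (dser_mono (k := 1)) hu.
Qed.

(** H cap F' is trivial in S, so H consists of powers of c, which T fixes. *)
Lemma retract_cyclic : retract m.+2 H.
Proof.
have [T [eT HT Tc]] := verbally_closed_endo sH vc Hc.
exists T; split=> [x y|]; first exact: endo_Seq.
split=> [x y|]; first exact/feq_Seq/eT.2.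
split=> // h Hh; have [t [v [Hv v1 hE]]] := cyclic_decomp sH Hc cyc Hh.
have v0 : Der m.+2 v by apply: cyclic_Der.
apply: Seq_trans (endo_Seq eT (feq_Seq _ hE)) _;
  apply: Seq_trans (feq_Seq _ (feq_sym hE)).
apply/clsP; rewrite cls_endo_cat // clsM; congr (_ * _)%g.
  by transitivity (1%g : Sgrp r m.+2); [|symmetry]; apply/cls_eq1 => //; apply: Der_endo.
transitivity (cls m.+2 (zexp (T c) t)); first exact/clsP/feq_Seq/endo_zexp.
by apply: cls_zexp; apply/clsP.
Qed.

End CyclicRetract.

(** * The abelian case *)

Section AbelianCase.
Variable r : nat.
Implicit Types (a b u v w : fword r).
Local Open Scope ring_scope.

Definition expo_row w : 'rV[int]_r := \row_l expo l w.

Definition row_word (y : 'rV[int]_r) : fword r :=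
  flatten [seq zexp [:: (l, true)] (y 0 l) | l <- enum 'I_r].

Lemma expo_gen (l j : 'I_r) : expo l [:: (j, true)] = (l == j)%:Z.
Proof. by rewrite /expo /= /fox1 /= eqxx andbT addr0; case: eqP. Qed.

Lemma row_wordK y : expo_row (row_word y) = y.
Proof.
apply/rowP => l; rewrite !mxE /row_word.
have -> : expo l (flatten [seq zexp [:: (j, true)] (y 0 j) | j <- enum 'I_r])
    = \sum_(j <- enum 'I_r) y 0 j * (l == j)%:Z.
  elim: (enum 'I_r) => [|j s IH]; first by rewrite big_nil.
  by rewrite big_cons /= expo_cat expo_zexp expo_gen IH.
rewrite big_enum (bigD1 l) //= eqxx mulr1 big1 ?addr0 // => j.
by rewrite eq_sym => /negbTE ->; rewrite mulr0.
Qed.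

Lemma expo_row_Seq u v : Seq 1 u v <-> expo_row u = expo_row v.
Proof.
rewrite expo_Seq; split=> [h|/rowP h l]; first by apply/rowP => l; rewrite !mxE.
by have := h l; rewrite !mxE.
Qed.

(** Take a Smith form M = L D R of the matrix of exponents. By purity the rows of R at nonzero
    invariant factors span the image of H. With E the projection onto those coordinates, R^-1 E R
    projects Z^r onto that image. *)
Lemma retract_abelian a b :
  verbally_closed 1 (Gen2 1 a b) -> retract 1 (Gen2 1 a b).
Proof.
move=> vc; set H := Gen2 1 a b in vc *.
have sH : wsubgroup H by apply: Gen2_subgroup.
pose M : 'M[int]_(2, r) := \matrix_(i, l) expo l (if i == 0 then a else b).
pose wd (x : 'rV[int]_2) := zexp a (x 0 0) ++ zexp b (x 0 1).
have Hwd x : H (wd x).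
  have [_ HM _] := sH.
  by apply: HM; apply: zexp_subgroup => //; [exact: g2_a|exact: g2_b].
have wdE x : expo_row (wd x) = x *m M.
  apply/rowP => l; rewrite !mxE expo_cat !expo_zexp big_ord_recl big_ord1 !mxE /=.
  by congr (_ + x 0 _ * _); apply: val_inj.
have HE h : H h -> exists x, expo_row h = x *m M.
  elim=> {h} [||| x y _ [p hp] _ [q hq]|x _ [p hp]|x y /expo_row_Seq xy _ [p hp]].
  - exists (\row_j (j == 0)%:Z); apply/rowP => l.
    by rewrite !mxE big_ord_recl big_ord1 !mxE /=; lia.
  - exists (\row_j (j == 1)%:Z); apply/rowP => l.
    by rewrite !mxE big_ord_recl big_ord1 !mxE /=; lia.
  - by exists 0; rewrite mul0mx; apply/rowP => l; rewrite !mxE.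
  - exists (p + q); rewrite mulmxDl -hp -hq; apply/rowP => l.
    by rewrite !mxE expo_cat.
  - by exists (- p); rewrite mulNmx -hp; apply/rowP => l; rewrite !mxE expo_winv.
  - by exists p; rewrite -xy.
(* n T w = T h = h = n w in Z^r, so w = T w there. *)
have pure h w n : H h -> n <> 0 -> expo_row h = n *: expo_row w ->
    exists x, expo_row w = x *m M.
  move=> Hh n0 hn; have [T [eT HT Th]] := verbally_closed_endo sH vc Hh.
  have [x hx] := HE _ (HT w); exists x; rewrite -hx.
  have hw : Seq 1 h (zexp w n).
    by apply/expo_row_Seq; rewrite hn; apply/rowP => l; rewrite !mxE expo_zexp.
  have /expo_row_Seq e : Seq 1 (zexp (T w) n) h.
    apply: Seq_trans Th; apply: Seq_trans (Seq_sym (endo_Seq eT hw)).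
    exact/Seq_sym/feq_Seq/endo_zexp.
  apply/rowP => l; move: e; rewrite hn => /rowP /(_ l).
  by rewrite !mxE expo_zexp => /(mulfI (introN eqP n0)).
have [L uL [R uR [d _ ME]]] := int_Smith_normal_form M.
set D := (\matrix_(i, j) _) in ME.
pose E : 'M[int]_r := \matrix_(i, j) ((i == j) && (i < 2)%N && (d`_i != 0))%:Z.
have DE : D *m E = D.
  apply/matrixP => i j; rewrite !mxE (bigD1 j) //= !mxE big1 => [|l lj]; last first.
    by rewrite !mxE (negbTE lj) mulr0.
  rewrite eqxx addr0; have [ij|ne] := eqVneq (i : nat) j; last by rewrite mul0r.
  by rewrite -ij ltn_ord /=; case: eqVneq => [->|_]; rewrite ?mul0r ?mulr1.
have [X XE] : exists X : 'M_(r, 2), E *m R = X *m M.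
  suff /choice[x hx] : forall i, exists x, row i (E *m R) = x *m M.
    exists (\matrix_i x i); apply/row_matrixP => i.
    by rewrite hx row_mul rowK.
  move=> i; have Ei : row i E = ((i < 2)%N && (d`_i != 0))%:Z *: delta_mx 0 i.
    apply/rowP => j; rewrite !mxE eqxx /= eq_sym.
    by case: (j == i); rewrite /= ?mulr1 ?mulr0.
  rewrite row_mul Ei -scalemxAl -rowE.
  case: ltnP => [i2|_]; last by exists 0; rewrite scale0r mul0mx.
  have [_|di] := eqVneq d`_i 0; first by exists 0; rewrite scale0r mul0mx.
  (* Row i of L^-1 M is d_i times row i of R, so purity applies. *)
  rewrite scale1r -[row i R]row_wordK.
  apply: (pure (wd (row (Ordinal i2) (invmx L))) _ d`_i (Hwd _)); first exact/eqP.
  rewrite row_wordK wdE -row_mul ME -mulmxA mulKmx // row_mul.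
  have -> : row (Ordinal i2) D = d`_i *: delta_mx 0 i.
    by apply/rowP => j; rewrite !mxE eqxx /= mulr_natr (eq_sym j).
  by rewrite -scalemxAl -rowE.
(* X supplies the exponents of a and b, so the values are words in H. *)
pose rho w := wd (expo_row w *m invmx R *m X).
have rhoE w : expo_row (rho w) = expo_row w *m invmx R *m E *m R.
  by rewrite wdE -!mulmxA XE.
exists rho; split=> [x y /expo_row_Seq xy|].
  by apply/expo_row_Seq; rewrite !rhoE xy.
split=> [x y|].
  apply/expo_row_Seq; have rowM u v : expo_row (u ++ v) = expo_row u + expo_row v.
    by apply/rowP => l; rewrite !mxE expo_cat.
  by rewrite (rowM (rho x)) !rhoE rowM !mulmxDl.
split=> [x|h Hh]; first exact: Hwd.
apply/expo_row_Seq; rewrite rhoE; have [x ->] := HE _ Hh.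
by rewrite ME -!mulmxA (mulmxA R) mulmxV // mul1mx (mulmxA D) DE.
Qed.

End AbelianCase.

(** Dividing by the gcd gives i' a + j' b = 0 with p i' + q j' = 1. Then c = p b - q a satisfies a =
    - j' c and b = i' c in Z^r. *)
Lemma dependent_cyclic r d (a b : fword r) (i j : int) : (0 < d)%N ->
  (i <> 0 \/ j <> 0)%R -> (forall l, i * expo l a + j * expo l b = 0)%R ->
  exists2 c, Gen2 d a b c &
    forall u, Gen2 d a b u -> exists t : int, forall l, (expo l u = t * expo l c)%R.
Proof.
move=> d0 ij0 hij; pose g := gcdz i j.
have g0 : (g <> 0)%R by move=> /eqP; rewrite gcdz_eq0 => /andP[/eqP i0 /eqP j0]; lia.
have [i' iE] := dvdzP (dvdz_gcdl i j); have [j' jE] := dvdzP (dvdz_gcdr i j).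
have [p [q pq]] := Bezoutz i j.
rewrite -/g in iE jE pq.
have pq1 : (p * i' + q * j' = 1)%R.
  apply: (mulIf (introN eqP g0)); rewrite mul1r mulrDl -!mulrA -iE -jE; exact: pq.
have hij' l : (i' * expo l a + j' * expo l b = 0)%R.
  apply: (mulfI (introN eqP g0)); rewrite mulr0 -(hij l) [in RHS]iE [in RHS]jE; ring.
have sH := Gen2_subgroup d a b.
exists (zexp b p ++ zexp a (- q)).
  have [_ HM _] := sH.
  by apply: HM; apply: zexp_subgroup => //; [exact: g2_b|exact: g2_a].
have cE l : (expo l (zexp b p ++ zexp a (- q)) = p * expo l b - q * expo l a)%R.
  by rewrite expo_cat !expo_zexp mulNr.
move=> u; elim=> {u} [|||x y _ [s hs] _ [t ht]|x _ [s hs]|x y xy _ [s hs]].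
- exists (- j')%R => l; rewrite cE; apply/eqP; rewrite -subr_eq0; apply/eqP.
  transitivity (p * (i' * expo l a + j' * expo l b)
    + (1 - (p * i' + q * j')) * expo l a)%R; first by ring.
  by rewrite hij' pq1 subrr mulr0 mul0r.
- exists i' => l; rewrite cE; apply/eqP; rewrite -subr_eq0; apply/eqP.
  transitivity (q * (i' * expo l a + j' * expo l b)
    + (1 - (p * i' + q * j')) * expo l b)%R; first by ring.
  by rewrite hij' pq1 subrr mulr0 mul0r.
- by exists 0%R => l; rewrite mul0r.
- by exists (s + t)%R => l; rewrite (expo_cat l x y) hs ht mulrDl.
- by exists (- s)%R => l; rewrite (expo_winv l x) hs mulNr.
- exists s => l; rewrite -hs; symmetry.
  by have /expo_Seq/(_ l) := Seq_le d0 xy.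
Qed.

Theorem theorem3 (r d : nat) (hr : 1 <= r) (hd : 1 <= d) (a b : fword r) :
  verbally_closed d (Gen2 d a b) -> retract d (Gen2 d a b).
Proof.
case: d hd => [//|[|m]] _ vc; first exact: retract_abelian.
have [ind|] := pselect (forall i j : int,
    (forall l, i * expo l a + j * expo l b = 0)%R -> i = 0%R /\ j = 0%R).
  exact: retract_rank2.
move=> dep.
have [i [j [hij nz]]] : exists i j : int,
    (forall l, i * expo l a + j * expo l b = 0)%R /\ (i <> 0 \/ j <> 0)%R.
  apply: contrapT => hn; apply: dep => i j hij.
  by apply: contrapT => nz; apply: hn; exists i, j; split=> //; lia.
have [c Hc cyc] := @dependent_cyclic r m.+2 a b i j isT nz hij.
apply: (retract_cyclic (Gen2_subgroup _ a b) Hc _ cyc vc) => x y.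
exact: g2_eq.
Qed.
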